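(* Let $p>2$ and $q=\frac p2+1$. Then $\mathcal{E}_{p,q}(\mu)$ is not attained for any $\mu>0$; that is, for every $\mu>0$ there is no $u\in H^1_\mu(\mathbb{R})$ such that $E_{p,q}(u)=\mathcal{E}_{p,q}(\mu)$.
   Context: Functions are real-valued. For $p,q>2$, $E_{p,q}(v):=\frac12\|v'\|_{L^2(\mathbb{R})}^2+\frac1p\|v\|_{L^p(\mathbb{R})}^p-\frac1q|v(0)|^q$ for $v\in H^1(\mathbb{R})$. For $\mu>0$, $H^1_\mu(\mathbb{R}):=\{v\in H^1(\mathbb{R}):\|v\|_{L^2(\mathbb{R})}^2=\mu\}$ and $\mathcal{E}_{p,q}(\mu):=\inf_{u\in H^1_\mu(\mathbb{R})}E_{p,q}(u)\in\mathbb{R}\cup\{-\infty\}$. *)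

(* Defs.v *)
From HB Require Import structures.
From mathcomp Require Import all_boot all_order all_algebra.
From mathcomp Require Import all_classical all_reals all_analysis.

Set Implicit Arguments.
Unset Strict Implicit.
Unset Printing Implicit Defensive.

Import Order.TTheory GRing.Theory Num.Theory.
Import numFieldNormedType.Exports.

Local Open Scope classical_set_scope.
Local Open Scope ring_scope.

Section Sobolev.
Context {R : realType}.

Local Notation mu := (@lebesgue_measure R).

(* C^1_c(R) *)
Definition test_function : set (R -> R) :=
  [set phi : R -> R | [/\ forall x : R, derivable phi x 1,
                 continuous (derive1 phi) &
                 compact (closure [set x | phi x != 0])]].

(* The integrands below are integrable when v and g are square integrable,
   so the default value of Rintegral is never met. *)
Definition is_weak_derivative (v g : R -> R) : Prop :=
  forall phi : R -> R, test_function phi ->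
    (\int[mu]_x (v x * derive1 phi x) = - \int[mu]_x (g x * phi x))%R.

Definition L2 : set (R -> R) := [set v | v \in Lfun mu 2%:E].

(* An element of H^1(R) is an equivalence class of functions with exactly one
   continuous representative; the class is represented by the latter, so that
   its value at 0 is [v 0]. *)
Definition H1 : set (R -> R) :=
  [set v : R -> R | [/\ continuous v, L2 v &
               exists2 g, L2 g & is_weak_derivative v g]].

(* For v in H^1(R) this is determined up to equality almost everywhere. *)
Definition weak_derivative (v : R -> R) : R -> R :=
  get [set g | L2 g /\ is_weak_derivative v g].

Local Open Scope ereal_scope.

Definition Lpnorm (p : R) (v : R -> R) : \bar R :=
  'N[mu]_(p%:E)[EFin \o v].

Definition H1_mass (m : R) : set (R -> R) :=
  [set v | H1 v /\ Lpnorm 2 v `^ 2 = m%:E].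

(* Extended real only because norms are; it is finite on H^1(R) for p, q > 2. *)
Definition energy (p q : R) (v : R -> R) : \bar R :=
  (2^-1)%:E * Lpnorm 2 (weak_derivative v) `^ 2
  + (p^-1)%:E * Lpnorm p v `^ p
  - (q^-1 * `|v 0%R| `^ q)%:E.

Definition ground_energy (p q m : R) : \bar R :=
  ereal_inf [set energy p q u | u in H1_mass m].

End Sobolev.

(* Main.v *)
(** With [k = sqrt (2 / p)], completing the square in
    [u' ^ 2 / 2 + |u| ^ p / p] gives, on each half-line, a kinetic plus
    potential energy at least [k * |u 0| ^ q / q] when [q = p / 2 + 1], hence
    [E u >= (2 * k - 1) / q * |u 0| ^ q].
    For [p <= 8], [2 * k >= 1] and spreading exponentials show that the infimum
    is at most [0], whereas [E u > 0] whenever [u <> 0]; the borderline case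
    [p = 8] needs the finite mass of [u], the equality case of the inequality
    being a power function which is not square integrable.
    For [p > 8], [2 * k < 1], and the truncated extremal profiles
    [(x + e) ^ (- 2 / (p - 2))], continued by an exponential tail that carries
    the prescribed mass, have energy tending to minus infinity as [e] tends to
    [0], whereas the energy of a single function is never minus infinity. *)
Require Import Defs.
From mathcomp Require Import all_boot all_order all_algebra.
From mathcomp Require Import all_classical all_reals all_analysis.
From mathcomp Require Import measurable_realfun.
From mathcomp Require Import ring lra.

Set Implicit Arguments.
Unset Strict Implicit.
Unset Printing Implicit Defensive.

Import Order.TTheory GRing.Theory Num.Theory.
Import numFieldNormedType.Exports.

Local Open Scope classical_set_scope.
Local Open Scope ring_scope.

(** * Integration along segments *)

(** The exponent q = p/2 + 1 is the one for which the cross term of the square, k |u|^(p/2) |u'|, is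
    the absolute value of the derivative of k |u|^q / q. It also makes the three energy terms of an
    extremal profile scale alike, so that the sign of 2k - 1 decides, and 2k >= 1 means p <= 8.

    The derivative of u is only a square integrable weak derivative, fixed by a choice. It is
    converted into the relation [primitive], for which a chain rule is proved for convex G with a
    continuous subgradient F; integration by parts and the calibration inequalities are instances of
    it. Boundary terms at infinity are made small along points where u is small. The competitors,
    which have a corner at 0, enter H^1 through the same relation.

    For p > 8 the mass constraint ties the height of the competitor to e, so a lower bound on the
    height, uniform in e, has to be available before e is chosen. *)

Section integrable_EFin.
Context d (T : measurableType d) (R : realType) (nu :
  {measure set T -> \bar R}).
Variables (D : set T) (mD : measurable D).
Implicit Types f g : T -> R.

Lemma integrable_EFinZ (k : R) f : nu.-integrable D (EFin \o f) ->
  nu.-integrable D (EFin \o (fun x => k * f x)).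
Proof.
move=> fi; have := integrableZl mD k fi.
by apply: eq_integrable => // x _ /=; rewrite EFinM.
Qed.

Lemma integrable_EFinD f g :
  nu.-integrable D (EFin \o f) -> nu.-integrable D (EFin \o g) ->
  nu.-integrable D (EFin \o (fun x => f x + g x)).
Proof.
move=> fi gi; have := integrableD mD fi gi.
by apply: eq_integrable => // x _ /=; rewrite EFinD.
Qed.

Lemma integrable_EFinB f g :
  nu.-integrable D (EFin \o f) -> nu.-integrable D (EFin \o g) ->
  nu.-integrable D (EFin \o (fun x => f x - g x)).
Proof.
move=> fi gi; have := integrableB mD fi gi.
by apply: eq_integrable => // x _ /=; rewrite EFinB.
Qed.

End integrable_EFin.

Section segments.
Context {R : realType}.
Local Notation mu := (@lebesgue_measure R).

(** Continuous induction: the supremum of the points reachable from [a] can be passed by the local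
    hypothesis unless it is [b]. It turns estimates on short intervals into global ones when they
    add up along subdivisions. *)
Lemma segment_induction (P : R -> R -> Prop) (a b : R) : a <= b ->
  (forall x y z, a <= x -> x <= y -> y <= z -> z <= b ->
     P x y -> P y z -> P x z) ->
  (forall c, a <= c -> c <= b -> exists2 d : R, 0 < d &
     forall x y, a <= x -> x <= y -> y <= b -> c - d < x -> y < c + d -> P x y)
       ->
  P a b.
Proof.
move=> ab Ptrans Ploc.
pose S := [set x | [/\ a <= x, x <= b & P a x]].
have Sa : S a.
  have [d d0 Pd] := Ploc a (lexx _) ab.
  by split => //; apply: Pd => //; lra.
have supS : has_sup S by split; [exists a | exists b => x []].
have ac : a <= sup S by apply: ub_le_sup => //; exact: supS.2.
have cb : sup S <= b by apply: ge_sup => [|x []//]; exists a.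
have [d d0 Pd] := Ploc _ ac cb.
have [x [ax xb Pax] dx] := sup_adherent d0 supS.
have xc : x <= sup S by apply: ub_le_sup; [exact: supS.2|].
(* [y] is reachable through [x], yet lies beyond the supremum unless it is [b]. *)
pose y := Num.min b (sup S + d / 2).
have [yb yd] : y <= b /\ y <= sup S + d / 2.
  by split; rewrite /y ge_min lexx ?orbT.
have xy : x <= y by rewrite /y le_min xb /=; lra.
have Pay : P a y by apply: (Ptrans a x y) => //; apply: Pd => //; lra.
have yc : y <= sup S.
  by apply: ub_le_sup; [exact: supS.2|split => //; lra].
have yE : y = b by move: yc; rewrite /y; case: (leP b) => // *; lra.
by rewrite -yE.
Qed.

Lemma Rintegral_itv_cat (f : R -> R) (a b c : R) : a <= b -> b <= c ->
  mu.-integrable `[a, c] (EFin \o f) ->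
  \int[mu]_(x in `[a, c]) f x =
  \int[mu]_(x in `[a, b]) f x + \int[mu]_(x in `[b, c]) f x.
Proof.
move=> ab bc fi.
have := Rintegral_itvB fi (x := b); rewrite !bnd_simp => /(_ ab bc).
rewrite Rintegral_itv_obnd_cbnd//; first by move=> <-; lra.
by apply: integrableS fi => //; apply: subset_itvr; rewrite bnd_simp.
Qed.

(** Integral form of local absolute continuity; integrability is included so that the real-valued
    integral is meaningful. *)
Definition primitive (u g : R -> R) :=
  forall x y, x <= y -> mu.-integrable `[x, y] (EFin \o g) /\
    u y - u x = \int[mu]_(t in `[x, y]) g t.

Lemma integrable_mulC (w g : R -> R) (a b : R) : continuous w ->
  mu.-integrable `[a, b] (EFin \o g) ->
  mu.-integrable `[a, b] (EFin \o (fun x => w x * g x)).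
Proof.
move=> cw ig.
have bw : [bounded w x | x in `[a, b]].
  have /compact_bounded[M [_ Mw]] := continuous_compact
    (continuous_subspaceT cw) (@segment_compact _ a b).
  by exists M; split; rewrite ?num_real // => ? ? ? ?; exact: Mw.
have := @integrableMr _ _ _ mu `[a, b] _ w _ _ bw ig.
by apply=> //; apply: measurable_funTS; exact: continuous_measurable_fun.
Qed.

(* The hypothesis says that [F] is a subgradient of the convex function [G]; as
   [F] is continuous, this is a derivation-free way of writing [G' = F]. *)
Lemma primitive_chain (F G u g : R -> R) (a b : R) : continuous F ->
  (forall x y, F x * (y - x) <= G y - G x) ->
  continuous u -> primitive u g -> a <= b ->
  \int[mu]_(x in `[a, b]) (F (u x) * g x) = G (u b) - G (u a).
Proof.
move=> cF FG cu pu ab.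
have cFu : continuous (F \o u).
  by move=> x; apply: continuous_comp; [exact: cu|exact: cF].
have ig x y : x <= y -> mu.-integrable `[x, y] (EFin \o g).
  by move=> xy; have [] := pu x y xy.
have iFg x y : x <= y ->
    mu.-integrable `[x, y] (EFin \o (fun t => F (u t) * g t)).
  by move=> xy; apply: integrable_mulC => //; exact: ig.
have ing x y : x <= y -> mu.-integrable `[x, y] (EFin \o (fun t => `|g t|)).
  by move=> xy; have := integrable_norm (ig _ _ xy).
pose M x y := \int[mu]_(t in `[x, y]) `|g t|.
pose H x y := \int[mu]_(t in `[x, y]) (F (u t) * g t) - (G (u y) - G (u x)).
(* The right-hand side is additive in the interval and the error [H] is additive inside the norm, so
   it is enough to treat intervals so short that F(u) stays within [e] of a constant. *)
suff He (e : R) : 0 < e -> `|H a b| <= (2 * e) * M a b.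
  have M0 : 0 <= M a b by apply: Rintegral_ge0.
  apply/eqP; rewrite -subr_eq0 -normr_le0; apply/ler_addgt0Pl => e e0.
  rewrite addr0; apply: le_trans (He (e / 2 / (M a b + 1)) _) _.
    by rewrite !divr_gt0//; lra.
  have -> : 2 * (e / 2 / (M a b + 1)) * M a b = e * (M a b / (M a b + 1)).
    by field; lra.
  rewrite ger_pMr// ler_pdivrMr; lra.
move=> e0.
apply: (@segment_induction (fun x y => `|H x y| <= (2 * e) * M x y)) => //.
  move=> x y z ax xy yz zb h1 h2.
  have -> : H x z = H x y + H y z.
    by rewrite /H (Rintegral_itv_cat xy yz (iFg _ _ (le_trans xy yz))); lra.
  have -> : M x z = M x y + M y z.
    by rewrite /M (Rintegral_itv_cat xy yz (ing _ _ (le_trans xy yz))).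
  by rewrite mulrDr; apply: le_trans (ler_normD _ _) _; lra.
move=> c ac cb.
have /cvgrPdist_lt/(_ _ e0) := cFu c.
move=> [d /= d0 Fd]; exists d => // x y ax xy yb cx yc.
have near t : x <= t -> t <= y -> `|F (u c) - F (u t)| <= e.
  by move=> xt ty; apply/ltW/Fd; rewrite /= ltr_distl; lra.
have gM : `|u y - u x| <= M x y.
  by have [i ->] := pu x y xy; exact: le_normr_Rintegral.
(* The subgradients at the two ends enclose the increment of G between F(u x) (u y - u x) and F(u y)
   (u y - u x); both factors are within [e] of F(u c). *)
have h1 : `|G (u y) - G (u x) - F (u c) * (u y - u x)| <= e * M x y.
  apply: (@le_trans _ _ (e * `|u y - u x|)); last by rewrite ler_pM2l.
  have := FG (u x) (u y); have := FG (u y) (u x).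
  have := near x (lexx _) xy; have := near y xy (lexx _).
  rewrite !ler_norml => /andP[p3 p4] /andP[p1 p2] q1 q2.
  have [s|/ltW s] := lerP 0 (u y - u x).
    have k z : - e <= F (u c) - F z -> F z * (u y - u x) <=
        F (u c) * (u y - u x) + e * (u y - u x).
      by move=> hz; rewrite -mulrDl ler_wpM2r//; lra.
    have k' z : F (u c) - F z <= e -> F (u c) * (u y - u x) -
        e * (u y - u x) <= F z * (u y - u x).
      by move=> hz; rewrite -mulrBl ler_wpM2r//; lra.
    have := k _ p3; have := k' _ p2.
    by rewrite ger0_norm// => h3 h4; apply/andP; split; lra.
  have k z : - e <= F (u c) - F z -> F (u c) * (u y - u x) +
      e * (u y - u x) <= F z * (u y - u x).
    by move=> hz; rewrite -mulrDl ler_wnM2r//; lra.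
  have k' z : F (u c) - F z <= e -> F z * (u y - u x) <=
      F (u c) * (u y - u x) - e * (u y - u x).
    by move=> hz; rewrite -mulrBl ler_wnM2r//; lra.
  have := k _ p1; have := k' _ p4.
  by rewrite ler0_norm// => h3 h4; apply/andP; split; lra.
have h2 : `|\int[mu]_(t in `[x, y]) (F (u t) * g t) - F (u c) * (u y - u x)|
    <= e * M x y.
  have [i ->] := pu x y xy.
  have iFc : mu.-integrable `[x, y] (EFin \o (fun t => F (u c) * g t)).
    exact: integrable_EFinZ.
  rewrite -RintegralZl// -RintegralB//; last exact: iFg.
  have ic : mu.-integrable `[x, y]
      (EFin \o (fun t => F (u t) * g t - F (u c) * g t)).
    by apply: integrable_EFinB => //; exact: iFg.
  apply: le_trans (le_normr_Rintegral _ ic) _ => //=.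
  rewrite /M -RintegralZl//; last exact: ing.
  apply: le_Rintegral => //.
  - by have := integrable_norm ic.
  - by apply: integrable_EFinZ => //; exact: ing.
  move=> t /=; rewrite in_itv /= => /andP[xt ty].
  by rewrite -mulrBl normrM ler_wpM2r// distrC near.
rewrite /H.
set A := \int[mu]_(_ in _) _ in h2 *; set B := G (u y) - _ in h1 *.
rewrite (_ : A - B = (A - F (u c) * (u y - u x)) -
                     (B - F (u c) * (u y - u x))); last by lra.
by apply: le_trans (ler_normB _ _) _; lra.
Qed.

End segments.

(** * Primitives *)

Section glue.
Context {R : realType}.

Definition glue (c : R) (f g : R -> R) (x : R) := if x <= c then f x else g x.

(** At the junction every difference quotient is one of [f] or one of [g], and both families have
    the same limit. *)
Lemma is_derive_glue (c : R) (f g df dg : R -> R) (x : R) :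
  f c = g c -> df c = dg c ->
  (x <= c -> is_derive x 1 f (df x)) -> (c <= x -> is_derive x 1 g (dg x)) ->
  is_derive x 1 (glue c f g) (glue c df dg x).
Proof.
move=> fg dfg hf hg.
have [xc|cx|xc] := ltgtP x c.
- rewrite /glue (ltW xc).
  apply: (@near_eq_is_derive _ _ _ f).
  + near=> y; rewrite ifT//.
    by apply/ltW; near: y; exact: lt_nbhsl.
  + by apply: hf; exact: ltW.
- rewrite /glue leNgt cx/=.
  apply: (@near_eq_is_derive _ _ _ g).
  + near=> y; rewrite ifF//; apply/negbTE; rewrite -ltNge.
    by near: y; exact: lt_nbhsr.
  + by apply: hg; exact: ltW.
subst x; rewrite /glue lexx.
have Qf : h^-1 *: ((f \o shift c) (h *: 1) - f c) @[h --> 0^'] --> df c.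
  by have [hf1 <-] := hf (lexx _); exact: hf1.
have Qg : h^-1 *: ((g \o shift c) (h *: 1) - g c) @[h --> 0^'] --> df c.
  by rewrite dfg; have [hg1 <-] := hg (lexx _); exact: hg1.
suff H : h^-1 *: ((glue c f g \o shift c) (h *: 1) - glue c f g c)
    @[h --> 0^'] --> df c.
  apply: DeriveDef; last exact/cvg_lim.
  by apply/cvg_ex; exists (df c).
apply/cvgrPdist_lt => e e0.
near=> h.
have hf1 : `|df c - h^-1 *: ((f \o shift c) (h *: 1) - f c)| < e.
  by near: h; move/cvgrPdist_lt : Qf; exact.
have hg1 : `|df c - h^-1 *: ((g \o shift c) (h *: 1) - g c)| < e.
  by near: h; move/cvgrPdist_lt : Qg; exact.
by rewrite /glue /= lexx; case: ifPn => _ //; rewrite fg.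
Unshelve. all: by end_near. Qed.

End glue.

Section primitives.
Context {R : realType}.
Local Notation mu := (@lebesgue_measure R).

Lemma continuous_integrable (f : R -> R) (a b : R) : continuous f ->
  mu.-integrable `[a, b] (EFin \o f).
Proof.
move=> cf; apply: continuous_compact_integrable; first exact: segment_compact.
exact: continuous_subspaceT.
Qed.

(** Integration by parts by polarization: the chain rule for s^2/2 is applied to [u], [v] and
    [u + v]. *)
Lemma primitive_mul (u v g h : R -> R) (a b : R) :
  continuous u -> continuous v -> primitive u g -> primitive v h -> a <= b ->
  \int[mu]_(x in `[a, b]) (u x * h x) + \int[mu]_(x in `[a, b]) (v x * g x) =
  u b * v b - u a * v a.
Proof.
move=> cu cv pu pv ab.
have sq (w k : R -> R) : continuous w -> primitive w k ->
    \int[mu]_(x in `[a, b]) (w x * k x) = w b ^+ 2 / 2 - w a ^+ 2 / 2.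
  move=> cw pw.
  apply: (@primitive_chain _ id (fun s => s ^+ 2 / 2)) => //.
    by move=> x.
  by move=> x y; have := sqr_ge0 (x - y); nra.
have pg x y : x <= y -> mu.-integrable `[x, y] (EFin \o g).
  by move=> xy; have [] := pu x y xy.
have ph x y : x <= y -> mu.-integrable `[x, y] (EFin \o h).
  by move=> xy; have [] := pv x y xy.
have puv : primitive (fun x => u x + v x) (fun x => g x + h x).
  move=> x y xy; split.
    by apply: integrable_EFinD => //; [exact: pg|exact: ph].
  rewrite RintegralD//; [|exact: pg|exact: ph].
  by rewrite -(pu x y xy).2 -(pv x y xy).2; ring.
have cuv : continuous (fun x => u x + v x).
  by move=> x; apply: cvgD; [exact: cu|exact: cv].
have := sq _ _ cuv puv.
have -> : \int[mu]_(x in `[a, b]) ((u x + v x) * (g x + h x)) =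
    \int[mu]_(x in `[a, b]) ((u x * h x + v x * g x) + (u x * g x + v x * h x)).
  by apply: eq_Rintegral => x _; ring.
have mc (w k : R -> R) : continuous w ->
    (forall x y, x <= y -> mu.-integrable `[x, y] (EFin \o k)) ->
    mu.-integrable `[a, b] (EFin \o (fun x => w x * k x)).
  by move=> cw ik; apply: integrable_mulC => //; exact: ik.
rewrite RintegralD//; last 2 first.
- by apply: integrable_EFinD => //; exact: mc.
- by apply: integrable_EFinD => //; exact: mc.
rewrite RintegralD//; [|exact: mc|exact: mc].
rewrite RintegralD//; [|exact: mc|exact: mc].
by rewrite (sq _ _ cu pu) (sq _ _ cv pv) /= => H; lra.
Qed.

Lemma derivable_continuous (f : R -> R) :
  (forall x, derivable f x 1) -> continuous f.
Proof.
by move=> df x; apply/differentiable_continuous/derivable1_diffP.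
Qed.

Lemma derivable_primitive (f : R -> R) : (forall x, derivable f x 1) ->
  continuous (derive1 f) -> primitive f (derive1 f).
Proof.
move=> df cf x y; rewrite le_eqVlt => /predU1P[<-|xy].
  by split; [exact: continuous_integrable|rewrite set_itv1 Rintegral_set1
    subrr].
split; first exact: continuous_integrable.
have cdf := derivable_continuous df.
have dLR : derivable_oo_LRcontinuous f x y.
  split; first by move=> z _; exact: df.
  - by apply: cvg_at_right_filter; exact: cdf.
  - by apply: cvg_at_left_filter; exact: cdf.
have := continuous_FTC2 xy (continuous_subspaceT cf) dLR (fun _ _ => erefl).
by rewrite /Rintegral => ->.
Qed.

Lemma Rintegral_itv_support (f : R -> R) (N : R) :
  (forall x, N <= `|x| -> f x = 0) ->
  \int[mu]_x f x = \int[mu]_(x in `[- N, N]) f x.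
Proof.
move=> f0; rewrite [RHS]Rintegral_mkcond; congr Rintegral; apply/funext => x.
rewrite patchE; case: ifPn => // /negP xN; apply: f0; rewrite leNgt.
apply/negP => h; apply: xN; rewrite inE /= in_itv /=.
by rewrite -ler_norml ltW.
Qed.

Lemma test_function_support (phi : R -> R) : test_function phi ->
  exists2 N : R, 0 < N & forall x, N <= `|x| -> phi x = 0 /\ derive1 phi x = 0.
Proof.
move=> [dphi cphi /compact_bounded[M [_ Mb]]].
pose N : R := `|M| + 1.
have hN (x : R) : N < `|x| -> phi x = 0.
  move=> Nx; apply/eqP/negPn/negP => px.
  have cx : closure [set x | phi x != 0] x by exact: subset_closure.
  have MN : M < N by rewrite /N (le_lt_trans (ler_norm _))// ltrDl.
  by have := Mb N MN x cx; rewrite /= leNgt Nx.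
exists (N + 1); first by rewrite /N; have := normr_ge0 M; lra.
move=> x Nx; have {}Nx : N < `|x| by lra.
split; first exact: hN.
rewrite derive1E (@near_eq_derive _ _ _ phi (cst 0)) ?derive_cst//.
near=> y; rewrite hN//=; near: y.
by have /cvgr_gt := @norm_continuous R R x; apply.
Unshelve. all: by end_near. Qed.

Lemma primitive_weak_derivative (v g : R -> R) : continuous v ->
  primitive v g -> is_weak_derivative v g.
Proof.
move=> cv pv phi tphi; have [N N0 suppN] := test_function_support tphi.
have [dphi cphi _] := tphi.
rewrite (@Rintegral_itv_support _ N); last first.
  by move=> x /suppN[_ ->]; rewrite mulr0.
rewrite (@Rintegral_itv_support (fun x => g x * phi x) N); last first.
  by move=> x /suppN[-> _]; rewrite mulr0.
have cphi' := derivable_continuous dphi.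
have NN : - N <= N by lra.
have := primitive_mul cv cphi' pv (derivable_primitive dphi cphi) NN.
have [-> _] : phi N = 0 /\ derive1 phi N = 0 by apply: suppN; exact: ler_norm.
have [-> _] : phi (- N) = 0 /\ derive1 phi (- N) = 0.
  by apply: suppN; rewrite normrN; exact: ler_norm.
rewrite !mulr0 subr0 => /eqP; rewrite addr_eq0 => /eqP ->.
by congr (- _); apply: eq_Rintegral => x _; rewrite mulrC.
Qed.

End primitives.

(** * Existence of primitives, and explicit C^1 test functions *)

Section smoothstep.
Context {R : realType}.
Local Notation mu := (@lebesgue_measure R).

Lemma primitive_exists (g : R -> R) :
  (forall x y, mu.-integrable `[x, y] (EFin \o g)) ->
  exists2 V : R -> R, continuous V & primitive V g.
Proof.
move=> ig.
pose V x := if 0 <= x then \int[mu]_(t in `[0, x]) g t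
            else - \int[mu]_(t in `[x, 0]) g t.
have pV : primitive V g.
  move=> x y xy; split=> //; rewrite /V.
  have [x0|x0] := leP 0 x.
    by rewrite (le_trans x0 xy) (Rintegral_itv_cat x0 xy)// addrAC subrr add0r.
  have [y0|y0] := leP 0 y.
    by rewrite (Rintegral_itv_cat (ltW x0) y0)// opprK addrC.
  by rewrite (Rintegral_itv_cat xy (ltW y0))// opprK addrC addrK.
exists V => // x.
pose N := `|x| + 1.
have xN : x \in `]- N, N[.
  by rewrite in_itv /= -ltr_norml /N ltrDl.
have NN : - N < N by move: xN; rewrite in_itv /=; lra.
have /continuous_within_itvP := parameterized_integral_continuous (ltW NN) (ig
  (- N) N).
move=> /(_ NN)[+ _ _] => /(_ x xN) cI.
(* To the right of [- N], [V] is a constant plus the integral from [- N], whose continuity is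
   known. *)
pose W y := V (- N) + parameterized_integral mu (- N) y g.
have cW : {for x, continuous W} by apply: cvgD; [exact: cvg_cst|exact: cI].
have WV : \forall y \near x, W y = V y.
  have : \forall y \near x, - N < y.
    by apply: lt_nbhsr; move: xN; rewrite in_itv /= => /andP[].
  apply: filterS => y Ny; rewrite /W /parameterized_integral.
  by rewrite -(pV _ _ (ltW Ny)).2 addrC subrK.
rewrite /continuous_at -(nbhs_singleton WV).
by apply: cvg_trans cW; apply: near_eq_cvg.
Qed.

Definition pospart (x : R) : R := Num.max x 0.

Lemma is_derive_pospart2 (x : R) :
  is_derive x 1 (fun y => pospart y ^+ 2) (2 * pospart x).
Proof.
have -> : (fun y => pospart y ^+ 2) = glue 0 (cst 0) (fun y : R => y ^+ 2).
  apply/funext => y; rewrite /glue /pospart; case: (leP y 0) => //.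
  by rewrite expr0n.
have -> : 2 * pospart x = glue 0 (cst 0) (fun y : R => 2 * y) x.
  by rewrite /glue /pospart; case: (leP x 0) => // _; rewrite mulr0.
apply: is_derive_glue.
- by rewrite expr0n.
- by rewrite mulr0.
- move=> _; apply: is_derive_eq; rewrite /GRing.scale /=; ring.
Qed.

(* A second difference of the C^1 function [pospart x ^ 2]: it increases from
   [0] to the constant [2 * d ^ 2] across [0, 2 * d]. *)
Definition smoothstep (d x : R) : R :=
  pospart x ^+ 2 - 2 * pospart (x - d) ^+ 2 + pospart (x - 2 * d) ^+ 2.
Definition hat (d x : R) : R :=
  2 * pospart x - 4 * pospart (x - d) + 2 * pospart (x - 2 * d).

Lemma is_derive_smoothstep (d c x : R) :
  is_derive x 1 (fun y => smoothstep d (y - c)) (hat d (x - c)).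
Proof.
have sh k : is_derive x 1 (fun y => pospart (y - k) ^+ 2) (2 * pospart (x - k)).
  apply: is_derive_eq.
    apply: (@is_derive1_comp _ (fun y => pospart y ^+ 2) (fun y => y - k)).
    exact: is_derive_pospart2.
  by rewrite subr0 mulr1.
have -> : (fun y => smoothstep d (y - c)) = (fun y => (pospart (y - c) ^+ 2 -
    2 * pospart (y - (c + d)) ^+ 2) + pospart (y - (c + 2 * d)) ^+ 2).
  by apply/funext => y; rewrite /smoothstep !opprD !addrA.
apply: is_derive_eq.
rewrite /hat !opprD !addrA /GRing.scale /=; ring.
Qed.

Lemma hat_ge0 (d x : R) : 0 <= d -> 0 <= hat d x.
Proof.
rewrite /hat /pospart => d0.
by case: (leP x 0); case: (leP (x - d) 0); case: (leP (x - 2 * d) 0) => *; lra.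
Qed.

Lemma hat_supp (d x : R) : 0 <= d -> x <= 0 \/ 2 * d <= x -> hat d x = 0.
Proof.
rewrite /hat /pospart => d0.
by case: (leP x 0); case: (leP (x - d) 0); case: (leP (x - 2 * d) 0) =>
 h1 h2 h3 [?|?]; lra.
Qed.

Lemma smoothstep_left (d x : R) : 0 <= d -> x <= 0 -> smoothstep d x = 0.
Proof.
by move=> d0 x0; rewrite /smoothstep /pospart !max_r; [ring|lra..].
Qed.

Lemma smoothstep_right (d x : R) :
  0 <= d -> 2 * d <= x -> smoothstep d x = 2 * d ^+ 2.
Proof.
by move=> d0 x0; rewrite /smoothstep /pospart !max_l; [ring|lra..].
Qed.

Lemma continuous_hat (d : R) : continuous (hat d).
Proof.
have cp (c : R) : continuous (fun x => pospart (x - c)).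
  move=> x; apply: (@continuous_max _ _ (fun x => x - c) (cst 0)).
    by apply: cvgB; [exact: cvg_id|exact: cvg_cst].
  exact: cvg_cst.
move=> x; rewrite /hat; apply: cvgD; last first.
  by apply: cvgM; [exact: cvg_cst|exact: cp].
apply: cvgB; last by apply: cvgM; [exact: cvg_cst|exact: cp].
apply: cvgM; first exact: cvg_cst.
have := cp 0 x; rewrite /continuous_at subr0.
by under eq_fun do rewrite subr0.
Qed.

(** Both steps end at the same height 2 d^2, so their difference vanishes outside [a, b + 2d]. *)
Lemma test_smoothstep (a b d : R) : a <= b -> 0 <= d ->
  test_function (fun x => smoothstep d (x - a) - smoothstep d (x - b)) /\
  derive1 (fun x => smoothstep d (x - a) - smoothstep d (x - b)) =
    (fun x => hat d (x - a) - hat d (x - b)).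
Proof.
move=> ab d0.
set phi := (fun x => smoothstep d (x - a) - smoothstep d (x - b)).
have dphi (x : R) : is_derive x 1 phi (hat d (x - a) - hat d (x - b)).
  by apply: is_deriveB; exact: is_derive_smoothstep.
have phiE : derive1 phi = (fun x => hat d (x - a) - hat d (x - b)).
  by apply/funext => x; rewrite derive1E derive_val.
split=> //; split.
- by move=> x.
- rewrite phiE => x.
  have c z : {for x, continuous (fun y => hat d (y - z))}.
    apply: (@continuous_comp _ _ _ (fun y => y - z));
      last exact: continuous_hat.
    by apply: cvgB; [exact: cvg_id|exact: cvg_cst].
  by apply: cvgB; exact: c.
- apply: (@subclosed_compact _ _ `[a, b + 2 * d]).
  + exact: closed_closure.
  + exact: segment_compact.
  + rewrite [X in _ `<=` X](iffLR (closure_id _)); last exact: interval_closed.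
    apply: closureS => x /= px; rewrite in_itv /=.
    apply/andP; split; rewrite leNgt; apply/negP => h; move/eqP: px; apply.
      by rewrite /phi !smoothstep_left; lra.
    by rewrite /phi !smoothstep_right; lra.
Qed.

End smoothstep.

(** * Weak derivatives and primitives *)

Section weak_derivative_primitive.
Context {R : realType}.
Local Notation mu := (@lebesgue_measure R).

(* If [d a <> d b], test against a function whose derivative is a hat near [a]
   minus a hat near [b]. *)
Lemma weak_derivative_zero_constant (d : R -> R) (a b : R) : continuous d ->
  (forall phi, test_function phi -> \int[mu]_x (d x * derive1 phi x) = 0) ->
  a < b -> d a = d b.
Proof.
move=> cd wd ab; apply/eqP/negPn/negP => dab.
wlog dab' : d cd wd dab / d b < d a.
  move=> W; have [h|h|/eqP] := ltgtP (d a) (d b); last by rewrite (negbTE dab).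
    apply: (W (fun x => - d x)).
    - by move=> x; apply: cvgN; exact: cd.
    - move=> phi tphi; have := wd phi tphi.
      have [N N0 supp] := test_function_support tphi.
      rewrite (@Rintegral_itv_support _ _ N); last by move=> x /supp[_ ->];
        rewrite mulr0.
      rewrite (@Rintegral_itv_support _ _ N); last by move=> x /supp[_ ->];
        rewrite mulr0.
      have [_ cphi _] := tphi.
      under [in X in _ -> X]eq_Rintegral do rewrite mulNr -mulN1r.
      rewrite RintegralZl//; last first.
        apply: continuous_integrable => x.
        by apply: cvgM; [exact: cd|exact: cphi].
      by move=> ->; rewrite mulr0.
    - by rewrite eqr_opp.
    - by rewrite ltrN2.
  exact: (W d).
(* With [c] the midpoint and [e] a quarter of the gap, d - c exceeds [e] near [a] and is below [- e]
   near [b]. *)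
pose c := (d a + d b) / 2; pose e := (d a - d b) / 4.
have e0 : 0 < e by rewrite /e; lra.
have /cvgrPdist_lt/(_ _ e0)[da /= da0 Da] := cd a.
have /cvgrPdist_lt/(_ _ e0)[db /= db0 Db] := cd b.
(* The hats have width 2r, hence fit inside both neighbourhoods. *)
pose r := Num.min da db / 4.
have [r0 [ra rb]] : 0 < r /\ 2 * r < da /\ 2 * r < db.
  rewrite /r; have [h|h] := leP da db; split; [lra|split; lra|lra|split; lra].
have [tphi phiE] := test_smoothstep (ltW ab) (ltW r0).
set phi := (fun x => smoothstep r (x - a) - _) in tphi phiE.
have [dphi cphi _] := tphi.
have [N N0 supp] := test_function_support tphi.
pose M := N + `|a| + 2 * r.
have NM : N <= M by rewrite /M; have := normr_ge0 a; lra.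
have {}supp x : M <= `|x| -> phi x = 0 /\ derive1 phi x = 0.
  by move=> Mx; apply: supp; lra.
have M0 : - M < M by lra.
have d0 := wd _ tphi.
rewrite (@Rintegral_itv_support _ _ M) in d0; last by move=> x /supp[_ ->];
  rewrite mulr0.
have int_phi : \int[mu]_(x in `[- M, M]) derive1 phi x = 0.
  have [_ <-] := derivable_primitive dphi cphi (ltW M0).
  have [-> _] : phi M = 0 /\ derive1 phi M = 0 by apply: supp; exact: ler_norm.
  have [-> _] : phi (- M) = 0 /\ derive1 phi (- M) = 0.
    by apply: supp; rewrite normrN; exact: ler_norm.
  by rewrite subrr.
have chat z : continuous (fun y : R => hat r (y - z)).
  move=> x; apply: (@continuous_comp _ _ _ (fun y => y - z));
    last exact: continuous_hat.
  by apply: cvgB; [exact: cvg_id|exact: cvg_cst].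
have int_hat : \int[mu]_(x in `[- M, M]) hat r (x - a) = 2 * r ^+ 2.
  have dE : derive1 (fun y => smoothstep r (y - a)) = (fun y => hat r (y - a)).
    by apply/funext => x; rewrite derive1E;
      have [_] := is_derive_smoothstep r a x.
  have pr : primitive (fun y => smoothstep r (y - a))
      (derive1 (fun y => smoothstep r (y - a))).
    apply: derivable_primitive; last by rewrite dE.
    by move=> x; have [] := is_derive_smoothstep r a x.
  rewrite -dE -(pr _ _ (ltW M0)).2.
  rewrite smoothstep_right ?smoothstep_left ?subr0//; first exact: ltW.
  - by rewrite /M; have := ler_norm (- a); rewrite normrN; lra.
  - exact: ltW.
  - by rewrite /M; have := ler_norm a; lra.
(* The integral of [derive1 phi] being 0, subtracting [c] does not change the right-hand side, which
   is 0; the left-hand side is 2 e r^2 > 0. *)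
have : \int[mu]_(x in `[- M, M]) (e * hat r (x - a)) <=
    \int[mu]_(x in `[- M, M]) (d x * derive1 phi x - c * derive1 phi x).
  have c1 : continuous (fun x => d x * derive1 phi x).
    by move=> x; apply: cvgM; [exact: cd|exact: cphi].
  have c2 : continuous (fun x => c * derive1 phi x).
    by move=> x; apply: cvgM; [exact: cvg_cst|exact: cphi].
  apply: le_Rintegral => //.
  - by apply: continuous_integrable => x; apply: cvgM;
    [exact: cvg_cst|exact: chat].
  - by apply: continuous_integrable => x; apply: cvgB; [exact: c1|exact: c2].
  move=> x _; rewrite phiE -mulrBl mulrBr.
  have h1 : e * hat r (x - a) <= (d x - c) * hat r (x - a).
    have [xa|xa] := boolP (0 < x - a < 2 * r).
      rewrite ler_wpM2r ?hat_ge0 ?(ltW r0)//.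
      have /= := Da x; rewrite /ball_ /= !ltr_distl => /(_ _)/andP[|].
        by lra.
      by rewrite /e /c in e0 *; lra.
    rewrite hat_supp ?mulr0 ?(ltW r0)//.
    by move: xa; rewrite negb_and -!leNgt => /orP[]; [left|right].
  have h2 : (d x - c) * hat r (x - b) <= 0.
    have [xb|xb] := boolP (0 < x - b < 2 * r).
      rewrite mulr_le0_ge0 ?hat_ge0 ?(ltW r0)//.
      have /= := Db x; rewrite /ball_ /= !ltr_distl => /(_ _)/andP[|].
        by lra.
      by rewrite /e /c in e0 *; lra.
    rewrite hat_supp ?mulr0 ?(ltW r0)//.
    by move: xb; rewrite negb_and -!leNgt => /orP[]; [left|right].
  by lra.
have c1 : continuous (fun x => d x * derive1 phi x).
  by move=> x; apply: cvgM; [exact: cd|exact: cphi].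
have c2 : continuous (fun x => c * derive1 phi x).
  by move=> x; apply: cvgM; [exact: cvg_cst|exact: cphi].
rewrite RintegralB//; [|exact: continuous_integrable..].
rewrite RintegralZl//; last exact: continuous_integrable.
rewrite RintegralZl//; last exact: continuous_integrable.
rewrite d0 int_phi int_hat mulr0 subrr leNgt => /negP; apply.
by rewrite mulr_gt0// mulr_gt0// exprn_gt0.
Qed.

(** Du Bois-Reymond: if [V] is a primitive of [g], then v - V is continuous with zero weak
    derivative, hence constant. *)
Lemma weak_derivative_primitive (v g : R -> R) : continuous v ->
  (forall x y, mu.-integrable `[x, y] (EFin \o g)) ->
  is_weak_derivative v g -> primitive v g.
Proof.
move=> cv ig wv; have [V cV pV] := primitive_exists ig.
move=> x y xy; split=> //; rewrite -(pV _ _ xy).2.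
suff : v x - V x = v y - V y by lra.
move: xy; rewrite le_eqVlt => /predU1P[->//|].
apply: (@weak_derivative_zero_constant (fun x => v x - V x)).
  by move=> z; apply: cvgB; [exact: cv|exact: cV].
move=> phi tphi; have [_ cphi _] := tphi.
have [N N0 supp] := test_function_support tphi.
have := wv _ tphi; rewrite -(primitive_weak_derivative cV pV tphi) => /eqP.
rewrite -subr_eq0 => /eqP.
have s0 (w : R -> R) z : N <= `|z| -> w z * derive1 phi z = 0.
  by move=> /supp[_ ->]; rewrite mulr0.
rewrite (@Rintegral_itv_support _ _ N); last exact: s0.
rewrite (@Rintegral_itv_support _ _ N); last exact: s0.
rewrite (@Rintegral_itv_support _ _ N); last exact: (s0 (fun x => v x - V x)).
have ic (w : R -> R) : continuous w ->
    mu.-integrable `[- N, N] (EFin \o (fun x => w x * derive1 phi x)).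
  by move=> cw; apply: continuous_integrable => z; apply: cvgM;
    [exact: cw|exact: cphi].
rewrite -RintegralB//; [|exact: ic..].
by move=> <-; apply: eq_Rintegral => z _; rewrite mulrBl.
Qed.

End weak_derivative_primitive.

(** * Square integrable derivatives and the value of the energy *)

Section square_integrable.
Context {R : realType}.
Local Notation mu := (@lebesgue_measure R).

Lemma Lpnorm_poweR (p : R) (w : R -> R) : p != 0 ->
  (Lpnorm p w `^ p = \int[mu]_x (`|w x| `^ p)%:E)%E.
Proof. by move=> p0; rewrite /Lpnorm poweR_Lnorm. Qed.

Lemma Lpnorm2_sqr (w : R -> R) :
  (Lpnorm 2 w `^ 2 = \int[mu]_x (w x ^+ 2)%:E)%E.
Proof.
rewrite Lpnorm_poweR//; apply: eq_integral => x _.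
by rewrite powR_mulrn// real_normK// num_real.
Qed.

Lemma L2_measurable (w : R -> R) : L2 w -> measurable_fun setT w.
Proof. by rewrite /L2 /= inE => /andP[/[!inE]]. Qed.

Lemma L2_sqr_integrable (w : R -> R) : L2 w ->
  mu.-integrable setT (EFin \o (fun x => w x ^+ 2)).
Proof. by move=> w2; apply: Lfun2_integrable_sqr. Qed.

Lemma L2_intro (w : R -> R) : measurable_fun setT w ->
  (\int[mu]_x (w x ^+ 2)%:E < +oo)%E -> L2 w.
Proof.
move=> mw w2; rewrite /L2 /= inE; apply/andP; split; rewrite inE//=.
rewrite /finite_norm; apply: (@lty_poweRy _ _ 2) => //.
by have := Lpnorm2_sqr w; rewrite /Lpnorm => ->.
Qed.

Lemma L2_integrable_itv (w : R -> R) (x y : R) : L2 w ->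
  mu.-integrable `[x, y] (EFin \o w).
Proof.
move=> w2.
have i1 : mu.-integrable `[x, y] (EFin \o (fun t => 1 + w t ^+ 2)).
  apply: integrable_EFinD => //.
    by apply: continuous_integrable => z; exact: cvg_cst.
  by apply: (@integrableS _ _ _ _ setT) => //; exact: L2_sqr_integrable.
apply: le_integrable i1 => //.
  by apply/measurable_EFinP; apply: measurable_funTS; exact: L2_measurable.
move=> t _ /=; rewrite lee_fin (@ger0_norm _ (1 + _)); last first.
  by rewrite addr_ge0// sqr_ge0.
by rewrite -(real_normK (num_real (w t))); have := sqr_ge0 (`|w t| - 1); nra.
Qed.

Lemma L2_locally_integrable (w : R -> R) : L2 w -> locally_integrable setT w.
Proof.
move=> w2; split; [exact: L2_measurable|exact: openT|move=> K _ cK].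
have [M [_ MK]] := compact_bounded cK.
have mw := L2_measurable w2.
have KM : K `<=` `[- (`|M| + 1), `|M| + 1].
  move=> z Kz; rewrite /= in_itv /= -ler_norml; apply: (MK (`|M| + 1)) => //.
  by rewrite (le_lt_trans (ler_norm _))// ltrDl.
have := L2_integrable_itv (- (`|M| + 1)) (`|M| + 1) w2.
move=> /integrableP[_]; apply: le_lt_trans.
apply: ge0_subset_integral => //.
- exact: compact_measurable.
- by apply/measurable_EFinP/measurableT_comp => //; exact: measurable_funTS.
Qed.

(** At a common Lebesgue point x, [g] and [h] are both the derivative of the same function y -> v y
    - v (x - 1). *)
Lemma primitive_ae_unique (v g h : R -> R) : L2 g -> L2 h ->
  primitive v g -> primitive v h -> {ae mu, forall x, g x = h x}.
Proof.
move=> g2 h2 pg ph.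
have key (x : R) : lebesgue_pt g x -> lebesgue_pt h x -> g x = h x.
  move=> lg lh.
  have xx1 : x < x + 1 by rewrite ltrDl.
  have ax : (BLeft (x - 1)%R < BRight x)%E by rewrite lte_fin ltrBlDr ltrDl.
  have [_ <-] := FTC1_lebesgue_pt xx1 (L2_integrable_itv (x - 1) (x + 1) g2) ax
    lg.
  have [_ <-] := FTC1_lebesgue_pt xx1 (L2_integrable_itv (x - 1) (x + 1) h2) ax
    lh.
  congr (derive1 _ x); apply/funext => y.
  have [xy|yx] := leP (x - 1) y; last by rewrite set_itv_ge ?bnd_simp -?ltNge//
    !Rintegral_set0.
  by rewrite -(pg _ _ xy).2 -(ph _ _ xy).2.
have := lebesgue_differentiation (L2_locally_integrable h2).
have := lebesgue_differentiation (L2_locally_integrable g2).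
by apply: (@filterS2 _ _ (ae_filter_ringOfSetsType mu)) => x; exact: key.
Qed.

Lemma weak_derivativeP (v : R -> R) : H1 v ->
  L2 (weak_derivative v) /\ is_weak_derivative v (weak_derivative v).
Proof.
move=> [_ _ [g g2 vg]].
exact: (@getPex _ [set g | L2 g /\ is_weak_derivative v g]
  (ex_intro _ g (conj g2 vg))).
Qed.

Lemma H1_primitive (v : R -> R) : H1 v -> primitive v (weak_derivative v).
Proof.
move=> hv; have [d2 wd] := weak_derivativeP hv; have [cv _ _] := hv.
by apply: weak_derivative_primitive => // x y; exact: L2_integrable_itv.
Qed.

Lemma primitive_H1 (v g : R -> R) : continuous v -> L2 v -> L2 g ->
  primitive v g -> H1 v.
Proof.
by move=> cv v2 g2 pv; split=> //; exists g => //;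
  exact: primitive_weak_derivative.
Qed.

(** The energy is defined through a chosen weak derivative; almost everywhere uniqueness allows any
    square integrable derivative in its place. *)
Lemma energyE (p q : R) (v g : R -> R) : continuous v -> L2 v -> L2 g ->
  primitive v g -> p != 0 ->
  energy p q v = ((2^-1)%:E * \int[mu]_x (g x ^+ 2)%:E
    + (p^-1)%:E * \int[mu]_x (`|v x| `^ p)%:E - (q^-1 * `|v 0%R| `^ q)%:E)%E.
Proof.
move=> cv v2 g2 pv p0; rewrite /energy Lpnorm2_sqr Lpnorm_poweR//.
have hv := primitive_H1 cv v2 g2 pv.
have [d2 _] := weak_derivativeP hv.
congr (_ * _ + _ - _)%E; apply: ae_eq_integral => //.
- by apply/measurable_EFinP/measurable_funX; exact: L2_measurable.
- by apply/measurable_EFinP/measurable_funX; exact: L2_measurable.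
have := primitive_ae_unique d2 g2 (H1_primitive hv) pv.
by apply: (@filterS _ _ (ae_filter_ringOfSetsType mu)) => x h _ /=; rewrite h.
Qed.

End square_integrable.

(** * Lower bound for the energy *)

Section lower_bound.
Context {R : realType}.
Local Notation mu := (@lebesgue_measure R).

Lemma continuous_signed_powR (r : R) : 0 < r ->
  continuous (fun s : R => `|s| `^ r * s).
Proof.
move=> r0 s; have [->|s0] := eqVneq s 0.
  apply/cvgrPdist_lt => e e0; near=> t.
  rewrite mulr0 sub0r normrN normrM ger0_norm ?powR_ge0//.
  have t1 : `|t| <= 1.
    near: t; have := @norm_continuous R R 0; rewrite /continuous_at normr0.
    by move=> /cvgr_le; apply.
  have te : `|t| < e.
    near: t; have := @norm_continuous R R 0; rewrite /continuous_at normr0.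
    by move=> /cvgr_lt; apply.
  apply: le_lt_trans te; rewrite -[leRHS]mul1r ler_wpM2r//.
  have <- : 1 `^ r = 1 :> R by rewrite powR1.
  apply: ge0_ler_powR => //; rewrite ?nnegrE//.
  exact: ltW.
apply: cvgM; last exact: cvg_id.
apply: (@continuous_comp _ _ _ (fun t : R => `|t|) (fun t => t `^ r));
  first exact: norm_continuous.
apply/differentiable_continuous/derivable1_diffP/derivable_powR.
by rewrite in_itv /= normr_gt0 s0.
Unshelve. all: by end_near. Qed.

Lemma continuous_norm_powR (r : R) : 1 < r ->
  continuous (fun s : R => `|s| `^ r).
Proof.
move=> r1.
have -> : (fun s : R => `|s| `^ r) = (fun s => `|(`|s| `^ (r - 1) * s)|).
  apply/funext => t; rewrite normrM (ger0_norm (powR_ge0 _ _)).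
  have [->|t0] := eqVneq t 0; first by rewrite normr0 mulr0 powR0//; lra.
  rewrite -[X in _ = _ * X](powRr1 (normr_ge0 t)) -powRD.
    by congr (_ `^ _); lra.
  by rewrite normr_eq0 t0 implybT.
move=> s.
apply: (@continuous_comp _ _ _ (fun s : R => `|s| `^ (r - 1) * s)
  (fun t : R => `|t|)); last exact: norm_continuous.
by apply: continuous_signed_powR; lra.
Qed.

(** Young's inequality with exponents q and q/(q - 1), for |y| and |x|^(q - 1). This provides the
    subgradient that [primitive_chain] asks for. *)
Lemma signed_powR_subgradient (q x y : R) : 1 < q ->
  `|x| `^ (q - 2) * x * (y - x) <= q^-1 * `|y| `^ q - q^-1 * `|x| `^ q.
Proof.
move=> q1.
have q0 : 0 < q by lra.
have q10 : 0 < q - 1 by lra.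
have xx : `|x| `^ (q - 2) * x * x = `|x| `^ q.
  have [->|x0] := eqVneq x 0.
    by rewrite mulr0 normr0 powR0// gt_eqF.
  rewrite -mulrA -expr2 -(real_normK (num_real x)) -powR_mulrn// -powRD.
    by congr (_ `^ _); lra.
  by rewrite normr_eq0 x0 implybT.
have xy : `|x| `^ (q - 2) * x * y <= `|y| * `|x| `^ (q - 1).
  have [->|x0] := eqVneq x 0.
    by rewrite mulr0 mul0r mulr_ge0// powR_ge0.
  have -> : `|x| `^ (q - 1) = `|x| `^ (q - 2) * `|x|.
    rewrite -[X in _ = _ * X](powRr1 (normr_ge0 x)) -powRD.
      by congr (_ `^ _); lra.
    by rewrite normr_eq0 x0 implybT.
  rewrite mulrCA -mulrA ler_wpM2l ?powR_ge0//.
  by rewrite mulrC -normrM ler_norm.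
have pq : 0 < q / (q - 1) by rewrite divr_gt0.
have := @conjugate_powR _ `|y| (`|x| `^ (q - 1)) q (q / (q - 1))
  (normr_ge0 _) (powR_ge0 _ _) q0 pq.
have -> : q^-1 + (q / (q - 1))^-1 = 1 by field; lra.
move=> /(_ erefl); rewrite -powRrM.
have -> : (q - 1) * (q / (q - 1)) = q by field; lra.
have -> : `|x| `^ q / (q / (q - 1)) = `|x| `^ q - q^-1 * `|x| `^ q by field;
  lra.
rewrite mulrBr xx; move: xy; rewrite [_ / q]mulrC; lra.
Qed.

Lemma le_Rintegral_itv_setT (f : R -> R) (x y : R) :
  mu.-integrable setT (EFin \o f) -> (forall t, 0 <= f t) ->
  \int[mu]_(t in `[x, y]) f t <= \int[mu]_t f t.
Proof.
move=> fi f0; rewrite /Rintegral fine_le//.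
- by apply: integrable_fin_num => //; apply: integrableS fi.
- exact: integrable_fin_num.
- by apply: ge0_subset_integral => //; [exact: measurable_int fi|move=> t _;
  rewrite lee_fin].
Qed.

Lemma Rintegral_cst_itv (c x y : R) : x < y ->
  \int[mu]_(t in `[x, y]) c = c * (y - x).
Proof.
move=> xy; rewrite Rintegral_cst//; have := @lebesgue_measure_itv R `[x, y].
by rewrite /= lte_fin xy => ->.
Qed.

(** This serves as decay at infinity: boundary terms can be made small at suitable points
    arbitrarily far out. *)
Lemma L2_small_right (u : R -> R) (N e : R) : L2 u -> 0 < e ->
  exists2 x, N <= x & `|u x| < e.
Proof.
move=> u2 e0; apply: contrapT => H.
have {}H x : N <= x -> e <= `|u x|.
  by move=> Nx; rewrite leNgt; apply/negP => h; apply: H; exists x.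
have iu := L2_sqr_integrable u2.
set I := \int[mu]_t (u t ^+ 2).
have I0 : 0 <= I by apply: Rintegral_ge0 => t _; exact: sqr_ge0.
(* On a segment of this length the bound e^2 integrates to I + 1, more than the whole integral
   [I]. *)
pose M := N + (I + 1) / e ^+ 2.
have e2 : 0 < e ^+ 2 by rewrite exprn_gt0.
have NM : N <= M by rewrite lerDl divr_ge0 ?(ltW e2)//; lra.
have := le_Rintegral_itv_setT N M iu (fun t => sqr_ge0 _).
apply/negP; rewrite -ltNge.
have : \int[mu]_(t in `[N, M]) e ^+ 2 <= \int[mu]_(t in `[N, M]) (u t ^+ 2).
  apply: le_Rintegral => //.
  - by apply: continuous_integrable => z; exact: cvg_cst.
  - by apply: integrableS iu.
  move=> t /=; rewrite in_itv /= => /andP[Nt _].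
  by rewrite -(real_normK (num_real (u t))) lerXn2r ?nnegrE ?(ltW e0)// H.
apply: lt_le_trans.
have NM' : N < M by rewrite ltrDl divr_gt0//; lra.
rewrite Rintegral_cst_itv// /M addrAC subrr add0r mulrC divfK ?gt_eqF//.
by rewrite -/I; lra.
Qed.

Lemma L2_small_left (u : R -> R) (N e : R) : L2 u -> 0 < e ->
  exists2 x, x <= N & `|u x| < e.
Proof.
move=> u2 e0; apply: contrapT => H.
have {}H x : x <= N -> e <= `|u x|.
  by move=> Nx; rewrite leNgt; apply/negP => h; apply: H; exists x.
have iu := L2_sqr_integrable u2.
set I := \int[mu]_t (u t ^+ 2).
have I0 : 0 <= I by apply: Rintegral_ge0 => t _; exact: sqr_ge0.
pose M := N - (I + 1) / e ^+ 2.
have e2 : 0 < e ^+ 2 by rewrite exprn_gt0.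
have Q0 : 0 < (I + 1) / e ^+ 2 by rewrite divr_gt0//; lra.
have MN : M < N by rewrite /M; lra.
have := le_Rintegral_itv_setT M N iu (fun t => sqr_ge0 _).
apply/negP; rewrite -ltNge.
have : \int[mu]_(t in `[M, N]) e ^+ 2 <= \int[mu]_(t in `[M, N]) (u t ^+ 2).
  apply: le_Rintegral => //.
  - by apply: continuous_integrable => z; exact: cvg_cst.
  - by apply: integrableS iu.
  move=> t /=; rewrite in_itv /= => /andP[_ Nt].
  by rewrite -(real_normK (num_real (u t))) lerXn2r ?nnegrE ?(ltW e0)// H.
apply: lt_le_trans.
rewrite Rintegral_cst_itv// /M opprB.
rewrite addrC subrK mulrC divfK ?gt_eqF//.
by rewrite -/I; lra.
Qed.

(** Calibration: by the chain rule the left-hand side is the absolute integral of F(u) g, and |F g|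
    <= g^2/2 + F^2/2. A general [F] allows both the power calibration and the linear one of the
    borderline case. *)
Lemma primitive_energy_ge (F G u g : R -> R) (x y : R) :
  continuous F -> (forall s t, F s * (t - s) <= G t - G s) ->
  continuous u -> primitive u g -> L2 g -> x <= y ->
  `|G (u y) - G (u x)| <=
  \int[mu]_(t in `[x, y]) (2^-1 * g t ^+ 2 + 2^-1 * F (u t) ^+ 2).
Proof.
move=> cF FG cu pu g2 xy.
have cFu : continuous (F \o u).
  by move=> t; apply: continuous_comp; [exact: cu|exact: cF].
have iFg : mu.-integrable `[x, y] (EFin \o (fun t => F (u t) * g t)).
  by apply: integrable_mulC => //; exact: L2_integrable_itv.
rewrite -(primitive_chain cF FG cu pu xy).
apply: le_trans (le_normr_Rintegral _ iFg) _ => //.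
apply: le_Rintegral => //.
- by have := integrable_norm iFg.
- apply: integrable_EFinD => //.
    apply: integrable_EFinZ => //; apply: (@integrableS _ _ _ _ setT) => //.
    exact: L2_sqr_integrable.
  apply: continuous_integrable => t; apply: cvgM; first exact: cvg_cst.
  by rewrite expr2; apply: cvgM; exact: cFu.
move=> t _; rewrite normrM -(real_normK (num_real (g t))).
rewrite -(real_normK (num_real (F (u t)))).
by have := sqr_ge0 (`|F (u t)| - `|g t|); nra.
Qed.

End lower_bound.

(** * Strict lower bound for p <= 8 *)

Section positivity.
Context {R : realType}.
Local Notation mu := (@lebesgue_measure R).

Lemma energy_density_gt (p q : R) (u g : R -> R) : 2 < p -> p <= 8 ->
  q = p / 2 + 1 -> continuous u -> L2 u -> L2 g -> primitive u g ->
  mu.-integrable setT (EFin \o (fun t => `|u t| `^ p)) ->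
  (exists x, u x != 0) ->
  q^-1 * `|u 0| `^ q <
  \int[mu]_t (2^-1 * g t ^+ 2 + p^-1 * `|u t| `^ p).
Proof.
move=> p2 p8 qE cu u2 g2 pu ip [x0 ux0].
have q2 : 2 < q by lra.
pose k : R := Num.sqrt (2 / p).
have kk : k ^+ 2 = 2 / p by rewrite sqr_sqrtr// divr_ge0//; lra.
have k0 : 0 < k by rewrite sqrtr_gt0 divr_gt0//; lra.
have k12 : 1 <= 2 * k.
  rewrite -(@ler_pXn2r _ 2) ?nnegrE//; last by rewrite mulr_ge0// ltW.
  rewrite exprMn kk expr1n mulrA ler_pdivlMr; lra.
(* Normalised so that F^2/2 is the potential |s|^p / p, thanks to 2 (q - 1) = p. *)
pose F (s : R) : R := k * (`|s| `^ (q - 2) * s).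
pose G (s : R) : R := k * (q^-1 * `|s| `^ q).
have cF : continuous F.
  by move=> s; apply: cvgM; [exact: cvg_cst|apply: continuous_signed_powR; lra].
have FG s t : F s * (t - s) <= G t - G s.
  rewrite /F /G -mulrA -mulrBr ler_pM2l//.
  by apply: signed_powR_subgradient; lra.
have F2 s : 2^-1 * F s ^+ 2 = p^-1 * `|s| `^ p.
  rewrite /F exprMn kk mulrA; congr (_ * _); first by field; lra.
  have [->|s0] := eqVneq s 0.
    by rewrite mulr0 normr0 powR0 ?expr0n//; lra.
  rewrite exprMn -(real_normK (num_real s)) -!powR_mulrn ?powR_ge0//.
  rewrite -powRrM -powRD; last by rewrite normr_eq0 s0 implybT.
  by congr (_ `^ _); lra.
pose f (t : R) : R := 2^-1 * g t ^+ 2 + p^-1 * `|u t| `^ p.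
have f0 t : 0 <= f t.
  by rewrite addr_ge0// mulr_ge0 ?invr_ge0 ?sqr_ge0 ?powR_ge0//; lra.
have fi : mu.-integrable setT (EFin \o f).
  by apply: integrable_EFinD => //; apply: integrable_EFinZ => //;
    exact: L2_sqr_integrable.
have fi' x y : mu.-integrable `[x, y] (EFin \o f).
  by apply: integrableS fi.
rewrite -/(f _); set I := \int[mu]_t f t.
pose Phi (x y : R) : R := \int[mu]_(t in `[x, y]) f t.
have PhiI x y : Phi x y <= I by exact: le_Rintegral_itv_setT.
have Phi_cat x y z : x <= y -> y <= z -> Phi x z = Phi x y + Phi y z.
  by move=> xy yz; exact: Rintegral_itv_cat.
have PhiG x y : x <= y -> `|G (u y) - G (u x)| <= Phi x y.
  move=> xy; have := primitive_energy_ge cF FG cu pu g2 xy.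
  by under eq_Rintegral do rewrite F2.
have G0 s : 0 <= G s by rewrite !mulr_ge0 ?powR_ge0 ?invr_ge0//; lra.
have Gsmall (e : R) : 0 < e -> exists2 d, 0 < d & forall s, `|s| < d -> G s < e.
  move=> e0.
  have cG : continuous (fun s => G s).
    move=> s; apply: cvgM; first exact: cvg_cst.
    apply: cvgM; first exact: cvg_cst.
    by apply: continuous_norm_powR; lra.
  have /cvgrPdist_lt/(_ _ e0)[d /= d0 Gd] := cG 0.
  exists d => // s sd; have := Gd s; rewrite /ball_ /= sub0r normrN => /(_ sd).
  have -> : G 0 = 0 by rewrite /G normr0 powR0 ?mulr0//; lra.
  by rewrite sub0r normrN ger0_norm.
have right (N e : R) : 0 < e -> exists2 x, N <= x & G (u x) < e /\ `|u x| < e.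
  move=> e0; have [d d0 Gd] := Gsmall _ e0.
  have m0 : 0 < Num.min d e by rewrite lt_min d0.
  have [x Nx] := L2_small_right N u2 m0; rewrite lt_min => /andP[ux ue].
  by exists x => //; split=> //; exact: Gd.
have left (N e : R) : 0 < e -> exists2 x, x <= N & G (u x) < e.
  move=> e0; have [d d0 Gd] := Gsmall _ e0.
  by have [x Nx ux] := L2_small_left N u2 d0; exists x => //; exact: Gd.
(* Each of the two half-lines issuing from [x] contributes G(u x), up to a boundary term below
   e/2. *)
have two x : 2 * G (u x) <= I.
  apply/ler_addgt0Pl => e e0; have e2 : 0 < e / 2 by lra.
  have [a ax Ga] := left x _ e2; have [b xb [Gb _]] := right x _ e2.
  have := PhiI a b; rewrite (Phi_cat _ x)//.
  have := PhiG _ _ ax; have := PhiG _ _ xb;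
    rewrite !ler_norml => /andP[? ?] /andP[? ?].
  lra.
(* If u 0 = 0 the left-hand side is 0, and strictness comes from a point where [u] does not
   vanish. *)
have [u0|u0] := eqVneq (u 0) 0.
  rewrite u0 normr0 powR0 ?mulr0; last by lra.
  apply: lt_le_trans (two x0); rewrite mulr_gt0// mulr_gt0// mulr_gt0//.
    by rewrite invr_gt0; lra.
  by rewrite powR_gt0// normr_gt0.
have Q0 : 0 < q^-1 * `|u 0| `^ q.
  by rewrite mulr_gt0// ?powR_gt0 ?normr_gt0// invr_gt0; lra.
have [p8'|p8'] := ltP p 8.
  apply: lt_le_trans (two 0); rewrite /G mulrA ltr_pMl//.
  rewrite -(@ltr_pXn2r _ 2) ?nnegrE//; last by rewrite mulr_ge0// ltW.
  rewrite exprMn kk expr1n mulrA ltr_pdivlMr; lra.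
(* For [p = 8] the previous bound is an equality; a gain is obtained by using,
   beyond a point where [|u| = s] is small, the calibration [(s ^ 3 / 2) * u]. *)
have pE : p = 8 by lra.
have qE5 : q = 5%:R by lra.
have kE : k = 2^-1.
  have : (k - 2^-1) * (k + 2^-1) = 0 by rewrite -subr_sqr kk pE; field.
  by move=> /eqP; rewrite mulf_eq0 => /orP[] /eqP; lra.
have G5 s : G s = `|s| ^+ 5 / 10.
  by rewrite /G kE qE5 powR_mulrn//; lra.
rewrite qE5 powR_mulrn//.
pose m : R := \int[mu]_t (u t ^+ 2).
have iu := L2_sqr_integrable u2.
have um x y : \int[mu]_(t in `[x, y]) (u t ^+ 2) <= m.
  exact: (le_Rintegral_itv_setT x y iu (fun t => sqr_ge0 _)).
have m0 : 0 <= m by apply: Rintegral_ge0 => t _; exact: sqr_ge0.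
have nu0 : 0 < `|u 0| by rewrite normr_gt0.
(* s <= |u 0| lets |u| take the value [s] to the right of 0; s m <= 1 makes the mass penalty kap^2 m
   / 2 at most s^5 / 8. *)
have [s [s0 su sm]] : exists s, [/\ 0 < s, s <= `|u 0| & s * m <= 1].
  exists (Num.min `|u 0| (m + 1)^-1); split.
  - by rewrite lt_min nu0 invr_gt0; lra.
  - by rewrite ge_min lexx.
  - apply: (@le_trans _ _ ((m + 1)^-1 * m)).
      by rewrite ler_wpM2r// ge_min lexx orbT.
    by rewrite mulrC ler_pdivrMr; lra.
have [xs xs0 uxs] : exists2 x, 0 <= x & `|u x| = s.
  have [b b0 ub] := L2_small_right 0 u2 s0.
  have cn : {within `[0, b], continuous (fun t => `|u t|)}.
    apply: continuous_subspaceT => t.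
    by apply: (@continuous_comp _ _ _ u (fun t : R => `|t|));
      [exact: cu|exact: norm_continuous].
  have mM : Num.min `|u 0| `|u b| <= s <= Num.max `|u 0| `|u b|.
    by rewrite ge_min le_max su (ltW ub) orbT.
  have [x] := IVT b0 cn mM.
  by rewrite in_itv /= => /andP[? _] ?; exists x.
(* A slope l s^3 yields at least (l - l^2) s^5 / 2 on the tail, since s m <= 1; this is largest at l
   = 1/2, with value s^5 / 8, against s^5 / 10 for the power calibration. *)
pose kap : R := s ^+ 3 / 2.
have kap0 : 0 < kap by rewrite divr_gt0// exprn_gt0.
have tail y : xs <= y ->
    kap / 2 * (s ^+ 2 - `|u y| ^+ 2) <= Phi xs y + kap ^+ 2 / 2 * m.
  move=> xy.
  have cK : continuous (fun z : R => kap * z).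
    by move=> z; apply: cvgM; [exact: cvg_cst|exact: cvg_id].
  have KG a b : kap * a * (b - a) <= kap / 2 * b ^+ 2 - kap / 2 * a ^+ 2.
    have : 0 <= kap * (b - a) ^+ 2 by rewrite mulr_ge0 ?sqr_ge0// ltW.
    by lra.
  have := primitive_energy_ge cK KG cu pu g2 xy.
  rewrite -[u xs ^+ 2](real_normK (num_real _)) -[u y ^+ 2](real_normK
    (num_real _)) uxs.
  rewrite ler_norml => /andP[h _].
  have : \int[mu]_(t in `[xs, y]) (2^-1 * g t ^+ 2 + 2^-1 * (kap * u t) ^+ 2) <=
     \int[mu]_(t in `[xs, y]) (f t + kap ^+ 2 / 2 * u t ^+ 2).
    have iu' : mu.-integrable `[xs, y] (EFin \o (fun t => u t ^+ 2)).
      by apply: (@integrableS _ _ _ _ setT).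
    apply: le_Rintegral => //.
    - apply: integrable_EFinD => //; apply: integrable_EFinZ => //.
        by apply: (@integrableS _ _ _ _ setT) => //; exact: L2_sqr_integrable.
      have cku : continuous (fun t => kap * u t).
        by move=> t; apply: cvgM; [exact: cvg_cst|exact: cu].
      by apply: continuous_integrable => t; apply: cvgM; exact: cku.
    - by apply: integrable_EFinD => //; exact: integrable_EFinZ.
    move=> t _; rewrite /f exprMn.
    have : 0 <= p^-1 * `|u t| `^ p by rewrite mulr_ge0 ?powR_ge0// invr_ge0;
      lra.
    by lra.
  have iu' : mu.-integrable `[xs, y] (EFin \o (fun t => u t ^+ 2)).
    by apply: (@integrableS _ _ _ _ setT).
  rewrite RintegralD//; last exact: integrable_EFinZ.
  rewrite RintegralZl// -/(Phi _ _).
  have : kap ^+ 2 / 2 * \int[mu]_(t in `[xs, y]) (u t ^+ 2) <= kap ^+ 2 / 2 * m.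
    by rewrite ler_wpM2l// divr_ge0// sqr_ge0.
  by lra.
have s5 : 0 < s ^+ 5 by rewrite exprn_gt0.
(* The left half-line gives |u 0|^5 / 10, the segment up to [xs] gives (|u 0|^5 - s^5) / 10 and the
   tail s^5 / 8; the surplus is s^5 / 40. *)
suff : `|u 0| ^+ 5 / 5 + s ^+ 5 / 40 <= I by lra.
apply/ler_addgt0Pl => e e0.
(* The errors at the two ends are at most [e1] and [kap * e1]; the cap 1 turns |u b| < e1 into |u
   b|^2 <= e1. *)
pose e1 : R := Num.min 1 (e / (2 + kap)).
have e10 : 0 < e1 by rewrite lt_min ltr01 divr_gt0//; lra.
have e1e : e1 * (2 + kap) <= e.
  by rewrite -ler_pdivlMr; [rewrite ge_min lexx orbT|lra].
have e11 : e1 <= 1 by rewrite ge_min lexx.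
have [a a0 Ga] := left 0 _ e10; have [b xb [Gb ub]] := right xs _ e10.
have := PhiI a b; rewrite (Phi_cat a 0 b)//; last exact: le_trans xb.
rewrite (Phi_cat 0 xs b)//.
have := PhiG _ _ a0; have := PhiG _ _ xs0; have := tail _ xb.
rewrite !ler_norml => t1 /andP[t2 _] /andP[_ t3].
have ub2 : `|u b| ^+ 2 <= e1.
  by have := normr_ge0 (u b); nra.
have t4 : kap / 2 * `|u b| ^+ 2 <= kap * e1 by nra.
move: t2 t3; rewrite !G5 uxs => t2 t3.
have t5 : kap ^+ 2 / 2 * m <= s ^+ 5 / 8.
  have -> : kap ^+ 2 / 2 * m = s ^+ 5 / 8 * (s * m) by rewrite /kap; field.
  by rewrite ger_pMr// divr_gt0.
have t6 : kap / 2 * s ^+ 2 = s ^+ 5 / 4 by rewrite /kap; field.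
rewrite !G5 in Ga.
lra.
Qed.

End positivity.

(** * Competitors *)

Section profile.
Context {R : realType}.
Local Notation mu := (@lebesgue_measure R).

(* [t ^ (- rho)] up to [t = 1], then [exp (- sig * (t - 1))]; all powers of such
   profiles, and the derivative when [rho = sig], are again of this form. *)
Definition profile (rho sig t : R) : R :=
  Num.min t 1 `^ (- rho) * expR (- (sig * (Num.max t 1 - 1))).

(** Both branches vanish at t = 1 and the limit at infinity is 1/sig for sig > 0, so the integral of
    the profile from d > 0 is 1/sig minus the value at d. *)
Definition profile_primitive (rho sig : R) : R -> R :=
  glue 1 (fun t => (t `^ (1 - rho) - 1) / (1 - rho))
         (fun t => (1 - expR (- (sig * (t - 1)))) / sig).

Lemma profile_glue (rho sig : R) :
  profile rho sig =
  glue 1 (fun t => t `^ (- rho)) (fun t => expR (- (sig * (t - 1)))).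
Proof.
apply/funext => t; rewrite /profile /glue.
case: (leP t 1) => _; first by rewrite subrr mulr0 oppr0 expR0 mulr1.
by rewrite powR1 mul1r.
Qed.

Lemma profile_gt0 (rho sig t : R) : 0 < t -> 0 < profile rho sig t.
Proof. by move=> t0; rewrite mulr_gt0 ?expR_gt0// powR_gt0//
  lt_min t0 ltr01. Qed.

Lemma profile_powR (rho sig r t : R) : 0 < t ->
  profile rho sig t `^ r = profile (r * rho) (r * sig) t.
Proof.
move=> t0; rewrite /profile powRM ?expR_ge0 ?powR_ge0// -powRrM -expRM.
by congr (_ `^ _ * expR _); ring.
Qed.

Lemma profile_sqr (rho sig t : R) : 0 < t ->
  profile rho sig t ^+ 2 = profile (2 * rho) (2 * sig) t.
Proof.
by move=> t0; rewrite -profile_powR// powR_mulrn// ltW// profile_gt0.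
Qed.

Lemma profile_le1 (rho sig t : R) : t <= 1 -> profile rho sig t = t `^ (- rho).
Proof. by rewrite profile_glue /glue => ->. Qed.

Lemma is_derive_profile_primitive (rho sig t : R) : rho != 1 -> sig != 0 ->
  0 < t -> is_derive t 1 (profile_primitive rho sig) (profile rho sig t).
Proof.
move=> rho1 sig0 t0; rewrite profile_glue /profile_primitive.
have r1 : 1 - rho != 0 by rewrite subr_eq0 eq_sym.
apply: is_derive_glue => /=.
- by rewrite powR1 subrr mulr0 oppr0 expR0 subrr !mul0r.
- by rewrite powR1 subrr mulr0 oppr0 expR0.
- move=> _; have h := is_derive1_powR (1 - rho) t0.
  have -> : t `^ (- rho) = (1 - rho)^-1 * ((1 - rho) * t `^ (1 - rho - 1)).
    by rewrite mulKf//; congr (_ `^ _); ring.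
  have -> : (fun t : R => (t `^ (1 - rho) - 1) / (1 - rho)) =
      (fun t => (1 - rho)^-1 *: (t `^ (1 - rho) - 1)).
    by apply/funext => z; rewrite mulrC.
  have h2 : is_derive t 1 (fun z : R => z `^ (1 - rho) - 1)
      ((1 - rho) * t `^ (1 - rho - 1)).
    by apply: is_derive_eq; rewrite subr0.
  exact: is_deriveZ.
- move=> _.
  have h : is_derive t 1 (fun t : R => expR (- (sig * (t - 1))))
      (expR (- (sig * (t - 1))) * (- sig)).
    apply: (@is_derive1_comp _ expR (fun t : R => - (sig * (t - 1)))).
    by apply: is_derive_eq; rewrite /GRing.scale /=; ring.
  have -> : (fun t : R => (1 - expR (- (sig * (t - 1)))) / sig) =
      (fun t => sig^-1 *: (1 - expR (- (sig * (t - 1))))).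
    by apply/funext => z; rewrite mulrC.
  apply: is_derive_eq; rewrite /GRing.scale /=; field.
  by [].
Qed.

(** With equal parameters both branches have logarithmic derivative -c at 1, so the profile is C^1
    there; written this way, its derivative is read off from that of [profile_primitive]. *)
Lemma profileE (c t : R) : c != 0 ->
  profile c c t = 1 - c * profile_primitive (c + 1) c t.
Proof.
move=> c0; rewrite profile_glue /profile_primitive /glue; case: ifP => _.
  have -> : 1 - (c + 1) = - c by ring.
  by field.
by field.
Qed.

Lemma is_derive_profile (c t : R) : 0 < c -> 0 < t ->
  is_derive t 1 (profile c c) (- c * profile (c + 1) c t).
Proof.
move=> c0 t0.
have -> : profile c c = (fun t => 1 - c *: profile_primitive (c + 1) c t).
  by apply/funext => z; rewrite profileE// gt_eqF.
have h : is_derive t 1 (profile_primitive (c + 1) c) (profile (c + 1) c t).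
  apply: is_derive_profile_primitive => //; last by rewrite gt_eqF.
  by rewrite -subr_eq0 addrK gt_eqF.
apply: is_derive_eq; rewrite /GRing.scale /=; ring.
Qed.

Lemma continuous_profile (rho sig t : R) : 0 < t ->
  {for t, continuous (profile rho sig)}.
Proof.
move=> t0.
have c1 : {for t, continuous (fun z : R => Num.min z 1 `^ (- rho))}.
  apply: (@continuous_comp _ _ _ (fun z :
    R => Num.min z 1) (fun y => y `^ (- rho))).
    by apply: continuous_min; [exact: cvg_id|exact: cvg_cst].
  apply/differentiable_continuous/derivable1_diffP/derivable_powR.
  by rewrite in_itv /= andbT lt_min t0 ltr01.
have c2 : {for t, continuous (fun z : R => expR (- (sig * (Num.max z 1 - 1))))}.
  apply: (@continuous_comp _ _ _ (fun z :
    R => - (sig * (Num.max z 1 - 1))) expR);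
    last exact: continuous_expR.
  apply: cvgN; apply: cvgM; first exact: cvg_cst.
  apply: cvgB; last exact: cvg_cst.
  by apply: continuous_max; [exact: cvg_id|exact: cvg_cst].
by apply: cvgM; [exact: c1|exact: c2].
Qed.

Lemma continuous_profile_radial (rho sig b d : R) : 0 < b -> 0 < d ->
  continuous (fun x : R => profile rho sig (b * `|x| + d)).
Proof.
move=> b0 d0 x.
apply: (@continuous_comp _ _ _ (fun x : R => b * `|x| + d) (profile rho sig)).
  apply: cvgD; last exact: cvg_cst.
  by apply: cvgM; [exact: cvg_cst|exact: norm_continuous].
by apply: continuous_profile; rewrite ltr_wpDl// mulr_ge0// ltW.
Qed.

Lemma integral_profile_radial (rho sig b d : R) : 0 < b -> 0 < d -> 0 < sig ->
  rho != 1 ->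
  (\int[mu]_x (profile rho sig (b * `|x| + d))%:E =
   (2 / b * (sig^-1 - profile_primitive rho sig d))%:E)%E.
Proof.
move=> b0 d0 s0 rho1.
have T0 (x : R) : 0 < b * `|x| + d by rewrite ltr_wpDl// mulr_ge0// ltW.
have cf := @continuous_profile_radial rho sig b d b0 d0.
rewrite ge0_symfun_integralT//; last 2 first.
- by move=> x; exact/ltW/profile_gt0.
- by move=> x /=; rewrite normrN.
rewrite -set_itvcy.
pose F x := b^-1 * profile_primitive rho sig (b * x + d).
have dF (x : R) : 0 <= x -> is_derive x 1 F (profile rho sig (b * `|x| + d)).
  move=> x0; rewrite ger0_norm//.
  have t0 : 0 < b * x + d by rewrite ltr_wpDl// mulr_ge0// ltW.
  have h : is_derive x 1 (fun x : R => profile_primitive rho sig (b * x + d))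
      (profile rho sig (b * x + d) * b).
    apply: (@is_derive1_comp _ _ (fun x : R => b * x + d)).
      by apply: is_derive_profile_primitive => //; rewrite gt_eqF.
    by apply: is_derive_eq; rewrite /GRing.scale /=; ring.
  rewrite (_ : F = fun x => b^-1 *: profile_primitive rho sig (b * x + d))//.
  by apply: is_derive_eq; rewrite /GRing.scale /=; field; rewrite gt_eqF.
rewrite (@ge0_continuous_FTC2y _ _ F 0 (b^-1 * sig^-1)).
- by rewrite /F mulr0 add0r -EFinB -EFinM; congr EFin; ring.
- by move=> x _; exact/ltW/profile_gt0.
- exact: continuous_subspaceT.
- apply: cvgM; first exact: cvg_cst.
  have -> : sig^-1 = (1 - 0) / sig by rewrite subr0 mul1r.
  apply: (@cvg_trans _
    ((1 - expR (- (sig * (b * x + d - 1)))) / sig @[x --> +oo])).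
    apply: near_eq_cvg; near=> x.
    rewrite /profile_primitive /glue ifF//; apply/negbTE; rewrite -ltNge.
    rewrite -ltrBlDr mulrC -ltr_pdivrMr//.
    by near: x; apply: nbhs_pinfty_gt; exact: num_real.
  apply: cvgM; last exact: cvg_cst.
  apply: cvgB; first exact: cvg_cst.
  apply: (@cvg_comp _ _ _ (fun x => sig * (b * x + d - 1))
    (fun z => expR (- z)) _ (pinfty_nbhs R)); last exact: cvgr_expR.
  apply: gt0_cvgMry => //.
  have -> : (fun x : R => b * x + d - 1) = (fun x => (fun r => r + (d - 1)) (b
    * x)).
    by apply/funext => x; rewrite addrA.
  apply: (@cvg_comp _ _ _ (fun x => b * x) (fun r => r + (d - 1)) _
    (pinfty_nbhs R)).
    by apply: gt0_cvgMry => //; exact: cvg_id.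
  exact: cvg_addrr.
- by move=> x x0; have [] := dF x (ltW x0).
- apply: cvg_at_right_filter.
  by apply/differentiable_continuous/derivable1_diffP; have [] := dF 0 (lexx _).
- move=> x; rewrite in_itv /= andbT => x0.
  by rewrite derive1E; have [_ ->] := dF x (ltW x0).
Unshelve. all: by end_near. Qed.

End profile.

(** * Mass and energy of the two-sided profiles *)

Section competitor.
Context {R : realType}.
Local Notation mu := (@lebesgue_measure R).

(** The derivative may jump at 0, so the fundamental theorem is applied on each side with a
    continuous extension of that branch. *)
Lemma primitive_two_sided (v g g1 g2 : R -> R) :
  continuous v -> continuous g1 -> continuous g2 ->
  (forall x, 0 <= x -> g x = g1 x) -> (forall x, x < 0 -> g x = g2 x) ->
  (forall x : R, 0 < x -> is_derive x 1 v (g1 x)) ->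
  (forall x : R, x < 0 -> is_derive x 1 v (g2 x)) ->
  (forall x y, mu.-integrable `[x, y] (EFin \o g)) ->
  primitive v g.
Proof.
move=> cv cg1 cg2 gg1 gg2 d1 d2 ig.
have ftc (w : R -> R) (x y : R) : continuous w -> x < y ->
    (forall z, x < z -> z < y -> is_derive z 1 v (w z)) ->
    v y - v x = \int[mu]_(t in `[x, y]) w t.
  move=> cw xy dv; rewrite /Rintegral (@continuous_FTC2 _ w v)//.
  - exact: continuous_subspaceT.
  - split.
    + by move=> z; rewrite in_itv /= => /andP[xz zy]; have [] := dv z xz zy.
    + by apply: cvg_at_right_filter; exact: cv.
    + by apply: cvg_at_left_filter; exact: cv.
  - move=> z; rewrite in_itv /= => /andP[xz zy].
    by rewrite derive1E; have [_ ->] := dv z xz zy.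
have pos x y : 0 <= x -> x <= y -> v y - v x = \int[mu]_(t in `[x, y]) g t.
  move=> x0; rewrite le_eqVlt => /predU1P[<-|xy].
    by rewrite set_itv1 Rintegral_set1 subrr.
  rewrite (ftc g1 x y cg1 xy (fun z xz _ => d1 z (le_lt_trans x0 xz))).
  apply: eq_Rintegral => z; rewrite inE /= in_itv /= => /andP[xz _].
  by rewrite gg1//; exact: le_trans xz.
have neg x y : y <= 0 -> x <= y -> v y - v x = \int[mu]_(t in `[x, y]) g t.
  move=> y0; rewrite le_eqVlt => /predU1P[<-|xy].
    by rewrite set_itv1 Rintegral_set1 subrr.
  rewrite (ftc g2 x y cg2 xy (fun z _ zy => d2 z (lt_le_trans zy y0))).
  (* [g] may differ from [g2] at 0, so the right endpoint is dropped from both integrals. *)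
  rewrite -Rintegral_itv_bndo_bndc; last first.
    apply: integrableS (@continuous_integrable _ _ x y cg2) => //.
    by apply: subset_itvl; rewrite bnd_simp.
  rewrite -[RHS]Rintegral_itv_bndo_bndc; last first.
    by apply: integrableS (ig x y) => //; apply: subset_itvl; rewrite bnd_simp.
  apply: eq_Rintegral => z; rewrite inE /= in_itv /= => /andP[_ zy].
  by rewrite gg2//; exact: lt_le_trans y0.
move=> x y xy; split=> //.
have [x0|x0] := leP 0 x; first exact: pos.
have [y0|y0] := leP 0 y; last by apply: neg => //; exact: ltW.
rewrite (Rintegral_itv_cat (ltW x0) y0)// -(pos 0 y)// -(neg x 0)//;
  last exact: ltW.
ring.
Qed.

(** [s] sets the height and [b] the length scale; the shift [d] cuts off the singularity of the
    power, and d = 1 leaves a pure exponential. *)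
Definition competitor (s b c d x : R) : R := s * profile c c (b * `|x| + d).

Definition competitor_slope (s b c d x : R) : R :=
  (if 0 <= x then - (s * b * c) else s * b * c) *
  profile (c + 1) c (b * `|x| + d).

Variables (s b c d : R).
Hypotheses (s0 : 0 < s) (b0 : 0 < b) (c0 : 0 < c) (d0 : 0 < d).

Let T0 (x : R) : 0 < b * `|x| + d.
Proof. by rewrite ltr_wpDl// mulr_ge0// ltW. Qed.

Let continuous_competitor : continuous (competitor s b c d).
Proof.
move=> x; apply: cvgM; first exact: cvg_cst.
exact: continuous_profile_radial.
Qed.

Let measurable_slope : measurable_fun setT (competitor_slope s b c d).
Proof.
apply: measurable_funM.
  by apply: measurable_fun_ifT => //; apply: measurable_fun_ler.
by apply: continuous_measurable_fun; exact: continuous_profile_radial.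
Qed.

Let sqr_slope (x : R) : competitor_slope s b c d x ^+ 2 =
  (s * b * c) ^+ 2 * profile (2 * (c + 1)) (2 * c) (b * `|x| + d).
Proof.
by rewrite /competitor_slope exprMn profile_sqr//; case: ifP => _;
  rewrite ?sqrrN.
Qed.

Let integral_scaled (k rho sig : R) : 0 <= k -> 0 < sig -> rho != 1 ->
  (\int[mu]_x (k * profile rho sig (b * `|x| + d))%:E =
   (k * (2 / b * (sig^-1 - profile_primitive rho sig d)))%:E)%E.
Proof.
move=> k0 sg0 rho1; rewrite EFinM -integral_profile_radial//.
under eq_integral do rewrite EFinM.
rewrite ge0_integralZl//.
  apply/measurable_EFinP; apply: continuous_measurable_fun.
  exact: (@continuous_profile_radial _ rho sig b d b0 d0).
by move=> x _; rewrite lee_fin; exact/ltW/profile_gt0.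
Qed.

Let integral_sqr : 2 * c != 1 ->
  (\int[mu]_x (competitor s b c d x ^+ 2)%:E =
   (s ^+ 2 * (2 / b * ((2 * c)^-1 - profile_primitive (2 * c) (2 * c)
     d)))%:E)%E.
Proof.
move=> c1; rewrite -integral_scaled ?sqr_ge0 ?mulr_gt0//.
by apply: eq_integral => x _; rewrite /competitor exprMn profile_sqr.
Qed.

Let integral_slope :
  (\int[mu]_x (competitor_slope s b c d x ^+ 2)%:E =
   ((s * b * c) ^+ 2 * (2 / b *
     ((2 * c)^-1 - profile_primitive (2 * (c + 1)) (2 * c) d)))%:E)%E.
Proof.
rewrite -integral_scaled ?sqr_ge0 ?mulr_gt0//; last by apply/eqP => h;
  move: c0; lra.
by apply: eq_integral => x _; rewrite sqr_slope.
Qed.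

Let integral_powR (p : R) : 0 < p -> p * c != 1 ->
  (\int[mu]_x (`|competitor s b c d x| `^ p)%:E =
   (s `^ p * (2 / b *
     ((p * c)^-1 - profile_primitive (p * c) (p * c) d)))%:E)%E.
Proof.
move=> p0 pc; rewrite -integral_scaled ?powR_ge0 ?mulr_gt0//.
apply: eq_integral => x _; rewrite /competitor.
rewrite ger0_norm; last by rewrite mulr_ge0 ?(ltW s0)//; exact/ltW/profile_gt0.
by rewrite powRM ?profile_powR ?(ltW s0)//; exact/ltW/profile_gt0.
Qed.

Let L2_competitor : 2 * c != 1 -> L2 (competitor s b c d).
Proof.
move=> c1; apply: L2_intro; first exact: continuous_measurable_fun.
by rewrite integral_sqr// ltry.
Qed.

Let L2_slope : L2 (competitor_slope s b c d).
Proof. by apply: L2_intro => //; rewrite integral_slope// ltry. Qed.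

Let primitive_competitor : primitive (competitor s b c d) (competitor_slope s b
  c d).
Proof.
have cP (k : R) : continuous (fun x :
  R => k * profile (c + 1) c (b * `|x| + d)).
  move=> x; apply: cvgM; first exact: cvg_cst.
  exact: continuous_profile_radial.
have dP (k x : R) : 0 < k * x + d ->
    is_derive x 1 (fun y : R => s * profile c c (k * y + d))
      (- (s * k * c) * profile (c + 1) c (k * x + d)).
  move=> t0.
  have h : is_derive x 1 (fun y : R => profile c c (k * y + d))
      (- c * profile (c + 1) c (k * x + d) * k).
    apply: (@is_derive1_comp _ _ (fun y : R => k * y + d)).
      exact: is_derive_profile.
    by apply: is_derive_eq; rewrite /GRing.scale /=; ring.
  rewrite (_ : (fun y => s * _) = (fun y => s *: profile c c (k * y + d)))//.
  by apply: is_derive_eq; rewrite /GRing.scale /=; ring.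
apply: (@primitive_two_sided _ _
  (fun x => - (s * b * c) * profile (c + 1) c (b * `|x| + d))
  (fun x => s * b * c * profile (c + 1) c (b * `|x| + d))) => //.
- by move=> x x0; rewrite /competitor_slope x0.
- by move=> x x0; rewrite /competitor_slope leNgt x0.
- move=> x x0; rewrite gtr0_norm//.
  have t0 : 0 < b * x + d by rewrite addr_gt0// mulr_gt0.
  apply: near_eq_is_derive (dP b x t0); near=> y.
  by rewrite /competitor gtr0_norm//; near: y; exact: lt_nbhsr.
- move=> x x0; rewrite ltr0_norm//.
  have t0 : 0 < - b * x + d by rewrite mulNr -mulrN addr_gt0// mulr_gt0//
    oppr_gt0.
  have := dP (- b) x t0.
  rewrite (_ : - (s * - b * c) = s * b * c); last by ring.
  rewrite (_ : - b * x = b * - x); last by ring.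
  apply: near_eq_is_derive; near=> y.
  rewrite /competitor ltr0_norm; first by rewrite mulrN mulNr.
  by near: y; exact: lt_nbhsl.
- by move=> x y; exact: L2_integrable_itv.
Unshelve. all: by end_near. Qed.

Lemma competitor_H1_mass (m : R) : 2 * c != 1 ->
  2 * s ^+ 2 * ((2 * c)^-1 - profile_primitive (2 * c) (2 * c) d) = m * b ->
  H1_mass m (competitor s b c d).
Proof.
move=> c1 mE; split.
  by apply: primitive_H1 primitive_competitor => //; exact: L2_competitor.
rewrite Lpnorm2_sqr integral_sqr//; congr EFin.
rewrite -[RHS](mulfK (lt0r_neq0 b0)) -mE; ring.
Qed.

Lemma competitor_energy (p q : R) : 0 < p -> 2 * c != 1 -> p * c != 1 ->
  energy p q (competitor s b c d) =
  (s ^+ 2 * b * c ^+ 2 *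
     ((2 * c)^-1 - profile_primitive (2 * (c + 1)) (2 * c) d)
   + p^-1 * s `^ p * (2 / b) *
     ((p * c)^-1 - profile_primitive (p * c) (p * c) d)
   - q^-1 * (s * profile c c d) `^ q)%:E.
Proof.
move=> p0 c1 pc.
rewrite (energyE _ continuous_competitor (L2_competitor c1) L2_slope
  primitive_competitor); last by rewrite gt_eqF.
rewrite integral_slope integral_powR// -!(EFinM, EFinN, EFinD); congr EFin.
rewrite /competitor normr0 mulr0 add0r ger0_norm; last first.
  by rewrite mulr_ge0 ?(ltW s0)//; exact/ltW/profile_gt0.
congr (_ + _ - _); field; rewrite ?gt_eqF//.
Qed.

End competitor.

(** * The infimum *)

Section ground_energy.
Context {R : realType}.
Local Notation mu := (@lebesgue_measure R).

Lemma profile_primitive_le1 (rho sig t : R) : t <= 1 ->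
  profile_primitive rho sig t = (t `^ (1 - rho) - 1) / (1 - rho).
Proof. by rewrite /profile_primitive /glue => ->. Qed.

Lemma energy_arbitrarily_small (p q m e : R) :
  2 < p -> 0 < q -> 0 < m -> 0 < e ->
  exists2 v, H1_mass m v & (energy p q v < e%:E)%E.
Proof.
move=> p2 q0 m0 e0.
have p20 : 0 < p - 2 by lra.
pose h : R := (p ^+ 2 * e / (8 * m)) `^ (p - 2)^-1.
have B0 : 0 < p ^+ 2 * e / (8 * m).
  by rewrite divr_gt0 ?mulr_gt0 ?exprn_gt0//; lra.
have h0 : 0 < h by rewrite powR_gt0.
(* With b = s^2/m the mass is [m], the kinetic term is s^4/(2m) and the potential term 2 m s^(p - 2)
   / p^2; the three bounds on [s] make each at most e/4. The point term only lowers the energy. *)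
pose s : R := Num.min 1 (Num.min (m * e / 2) h).
have s0 : 0 < s by rewrite !lt_min ltr01 h0 divr_gt0 ?mulr_gt0.
have s1 : s <= 1 by rewrite ge_min lexx.
have sm : s <= m * e / 2 by rewrite !ge_min lexx orbT.
have sh : s <= h by rewrite !ge_min lexx !orbT.
have sp : s `^ (p - 2) <= p ^+ 2 * e / (8 * m).
  have -> : p ^+ 2 * e / (8 * m) = h `^ (p - 2).
    by rewrite /h -powRrM mulVf ?powRr1 ?(ltW B0)// gt_eqF.
  by apply: ge0_ler_powR => //; rewrite ?nnegrE ltW.
pose b : R := s ^+ 2 / m.
have b0 : 0 < b by rewrite divr_gt0// exprn_gt0.
have A1 rho sig : profile_primitive rho sig 1 = 0 :> R.
  by rewrite profile_primitive_le1// powR1 subrr mul0r.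
have n1 : 2 * 1 != 1 :> R by rewrite mulr1; apply/eqP => ?; lra.
exists (competitor s b 1 1).
  apply: competitor_H1_mass => //.
  by rewrite A1 /b; field; rewrite gt_eqF.
rewrite competitor_energy//; last 2 first.
- by lra.
- by apply/eqP => ?; lra.
rewrite lte_fin !A1.
have Q0 : 0 <= q^-1 * (s * profile 1 1 1) `^ q.
  by rewrite mulr_ge0 ?powR_ge0 ?invr_ge0 ?ltW.
have -> : s `^ p = s `^ (p - 2) * s ^+ 2.
  rewrite -(powR_mulrn 2 (ltW s0)) -powRD; last by rewrite (gt_eqF s0) implybT.
  by congr (_ `^ _); lra.
have T1 : s ^+ 2 * b * 1 ^+ 2 * ((2 * 1)^-1 - 0) <= e / 4.
  have -> : s ^+ 2 * b * 1 ^+ 2 * ((2 * 1)^-1 - 0) = s ^+ 4 / (2 * m).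
    by rewrite /b; field; rewrite gt_eqF.
  have s4 : s ^+ 4 <= s.
    by rewrite exprS ger_pMr// exprn_ile1// ltW.
  by rewrite ler_pdivrMr ?mulr_gt0//; lra.
have T2 : p^-1 * (s `^ (p - 2) * s ^+ 2) * (2 / b) * ((p * 1)^-1 - 0) <= e / 4.
  have -> : p^-1 * (s `^ (p - 2) * s ^+ 2) * (2 / b) * ((p * 1)^-1 - 0) =
      s `^ (p - 2) * (2 * m / p ^+ 2).
    by rewrite /b; field; rewrite !gt_eqF//; lra.
  have -> : e / 4 = p ^+ 2 * e / (8 * m) * (2 * m / p ^+ 2).
    by field; rewrite !gt_eqF//; lra.
  by rewrite ler_wpM2r// divr_ge0 ?sqr_ge0// mulr_ge0// ltW.
lra.
Qed.

Lemma energy_unbounded_below (p q m L : R) : 8 < p -> q = p / 2 + 1 -> 0 < m ->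
  0 <= L -> exists2 v, H1_mass m v & (energy p q v < (- L)%:E)%E.
Proof.
move=> p8 qE m0 L0.
have q0 : 0 < q by lra.
pose k : R := Num.sqrt (2 / p).
have kk : k ^+ 2 = 2 / p by rewrite sqr_sqrtr// divr_ge0//; lra.
have k0 : 0 < k by rewrite sqrtr_gt0 divr_gt0//; lra.
clearbody k.
have k12 : 2 * k < 1.
  rewrite -(@ltr_pXn2r _ 2) ?nnegrE//; last by rewrite mulr_ge0// ltW.
  rewrite exprMn kk expr1n mulrA ltr_pdivrMr; lra.
(* Decay exponent of the solutions of v' = - k v^(p/2): c + 1 = c p/2. Hence [pc] and [cq]: all
   three energy terms carry the same power d^(- (1 + 2c)), whereas 2c < 1 keeps the mass bounded. *)
pose c : R := 2 / (p - 2).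
have c0 : 0 < c by rewrite divr_gt0//; lra.
have c3 : 2 * c < 1 by rewrite mulrA ltr_pdivrMr; lra.
have c12 : 0 < 1 + 2 * c by lra.
have pc : p * c = 2 * (c + 1) by rewrite /c; field; lra.
have cq : c * q = 1 + 2 * c by rewrite /c qE; field; lra.
clearbody c.
(* With [b] proportional to s^(p/2 - 1), the mass constraint becomes s^(p/2 - 3) = N, solved by s =
   N^r. *)
pose r := (p / 2 - 3)^-1.
have p3 : 0 < p / 2 - 3 by lra.
have r0 : 0 < r by rewrite invr_gt0.
(* Lower bound for the height, independent of [d]: M >= 1/(2c) gives N >= 1/(m k). Thus [d] can be
   fixed before [s], which depends on it through [M]. *)
pose smin : R := (m * k)^-1 `^ r.
have mk0 : 0 < m * k by rewrite mulr_gt0.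
have smin0 : 0 < smin by rewrite powR_gt0// invr_gt0.
pose B : R := L / smin `^ q.
have sq0 : 0 < smin `^ q by rewrite powR_gt0.
have B0 : 0 <= B by rewrite divr_ge0 ?powR_ge0.
(* The prescribed value of d^(- (1 + 2c)), solving (2k (X - 1) - X)/q = - (k + B) - 1/q: here [k]
   absorbs the tail energy and [B], multiplied by s^q, exceeds [L]. *)
pose X : R := 1 + q * (k + B) / (1 - 2 * k).
have X1 : 1 <= X.
  have D0 : 0 <= 1 - 2 * k by lra.
  have kB : 0 <= k + B by rewrite addr_ge0// ltW.
  by rewrite lerDl divr_ge0// mulr_ge0// ltW.
pose d : R := X `^ (- (1 + 2 * c)^-1).
have d0 : 0 < d by rewrite powR_gt0; lra.
have d1 : d <= 1.
  rewrite /d powRN invf_le1 ?powR_gt0; [|lra..].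
  have := @ler_powR _ _ X1 0 (1 + 2 * c)^-1.
  by rewrite powRr0; apply; rewrite invr_ge0 ltW.
have dX : d `^ (- (1 + 2 * c)) = X.
  rewrite /d -powRrM mulrNN mulVf ?powRr1//; first lra.
  by rewrite gt_eqF.
clearbody d.
pose M : R := (2 * c)^-1 - profile_primitive (2 * c) (2 * c) d.
have MM : (2 * c)^-1 <= M.
  rewrite /M profile_primitive_le1// lerBrDr gerDl.
  apply: mulr_le0_ge0; last by rewrite invr_ge0; lra.
  have : d `^ (1 - 2 * c) <= 1 `^ (1 - 2 * c).
    by apply: ge0_ler_powR; rewrite ?nnegrE ?(ltW d0)//; lra.
  by rewrite powR1 subr_le0.
have M0 : 0 < M by apply: lt_le_trans MM; rewrite invr_gt0; lra.
pose N : R := 2 * M * c / (m * k).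
have N0 : 0 < N by rewrite divr_gt0// mulr_gt0// mulr_gt0.
pose s : R := N `^ r.
have s0 : 0 < s by rewrite powR_gt0.
have sN : s `^ (p / 2 - 3) = N.
  by rewrite /s -powRrM mulVf ?powRr1 ?(ltW N0)// gt_eqF.
have smins : smin <= s.
  apply: ge0_ler_powR; rewrite ?nnegrE ?(ltW r0) ?(ltW N0) ?invr_ge0 ?(ltW
    mk0)//.
  rewrite /N -[leLHS]mul1r ler_wpM2r ?invr_ge0 ?(ltW mk0)//.
  have c2 : 0 < 2 * c by rewrite mulr_gt0.
  rewrite mulrAC -ler_pdivrMl// mulr1; exact: MM.
clearbody s.
have sD (x y : R) : s `^ (x + y) = s `^ x * s `^ y.
  by rewrite powRD// (gt_eqF s0) implybT.
have s2 : s ^+ 2 = s `^ 2 by rewrite powR_mulrn// ltW.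
(* This [b] turns the power part of the competitor into a solution of
   [v' = - k * v ^ (p / 2)], the equality case of the lower bound. *)
pose b : R := k * s `^ (p / 2 - 1) / c.
have b0 : 0 < b by rewrite divr_gt0// mulr_gt0// powR_gt0.
have n1 : 2 * c != 1 by apply/eqP; lra.
have sq : 0 < s `^ q by rewrite powR_gt0.
exists (competitor s b c d).
  apply: competitor_H1_mass => //; rewrite -/M /b.
  have -> : p / 2 - 1 = 2 + (p / 2 - 3) by lra.
  by rewrite sD -s2 sN /N; field; rewrite !gt_eqF.
rewrite competitor_energy//; last 2 first.
- by lra.
- by rewrite pc; apply/eqP; lra.
have h1 : s ^+ 2 * b * c ^+ 2 = c * k * s `^ q.
  have -> : q = 2 + (p / 2 - 1) by lra.
  by rewrite sD -s2 /b; field; rewrite gt_eqF.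
have h2 : p^-1 * s `^ p * (2 / b) = c * k * s `^ q.
  have -> : p^-1 * s `^ p * (2 / b) = 2 / p * s `^ p / b.
    by field; rewrite !gt_eqF//; lra.
  have -> : p = q + (p / 2 - 1) by lra.
  rewrite sD -[X in 2 / X](_ : p = _); last by lra.
  rewrite -kk /b; field; rewrite !gt_eqF// powR_gt0//.
have h3 : (s * profile c c d) `^ q = s `^ q * X.
  rewrite profile_le1// powRM ?(ltW s0) ?powR_ge0// -powRrM.
  by rewrite -dX; congr (_ * _ `^ _); rewrite -cq; ring.
rewrite h1 h2 h3 pc lte_fin !profile_primitive_le1//.
have -> : 1 - 2 * (c + 1) = - (1 + 2 * c) by ring.
rewrite dX -pc.
(* The exponential tail leaves the constants 1/2 and 1/p; the coefficient of [X] is (2k - 1)/q <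
   0. *)
have -> : c * k * s `^ q * ((2 * c)^-1 - (X - 1) / - (1 + 2 * c)) +
    c * k * s `^ q * ((p * c)^-1 - (X - 1) / - (1 + 2 * c)) -
    q^-1 * (s `^ q * X) =
    s `^ q * (k * (1 / 2 + p^-1) + (2 * k * (X - 1) - X) / q).
  rewrite -cq; field; rewrite !gt_eqF//; lra.
have -> : (2 * k * (X - 1) - X) / q = - (k + B) - 1 / q.
  rewrite /X; field; rewrite !gt_eqF//; lra.
have p1 : k * (1 / 2 + p^-1) < k.
  rewrite gtr_pMr//.
  have : p^-1 <= 8^-1 by rewrite lef_pV2 ?posrE; lra.
  by lra.
have LB : L <= s `^ q * B.
  have -> : L = smin `^ q * B by rewrite /B mulrC divfK// gt_eqF.
  rewrite ler_wpM2r//; apply: ge0_ler_powR;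
    rewrite ?nnegrE ?(ltW smin0) ?(ltW s0)//.
  exact: ltW.
have q1 : 0 < 1 / q by rewrite divr_gt0.
have : s `^ q * (k * (1 / 2 + p^-1) + (- (k + B) - 1 / q)) < s `^ q * (- B).
  by rewrite ltr_pM2l//; lra.
lra.
Qed.

Lemma ground_energy_le (p q m : R) (v : R -> R) : H1_mass m v ->
  (ground_energy p q m <= energy p q v)%E.
Proof. by move=> mv; apply: ereal_inf_lbound; exists v. Qed.

Lemma energy_gt0 (p q m : R) (u : R -> R) : 2 < p -> p <= 8 -> q = p / 2 + 1 ->
  0 < m -> H1_mass m u -> (0 < energy p q u)%E.
Proof.
move=> p2 p8 qE m0 [hu um].
have p0 : p != 0 by rewrite gt_eqF//; lra.
have q0 : 0 < q by lra.
have [cu u2 _] := hu; have pu := H1_primitive hu;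
  have [g2 _] := weak_derivativeP hu.
set g := weak_derivative u in pu g2 *.
rewrite (energyE _ cu u2 g2 pu p0).
have ux : exists x, u x != 0.
  apply: contrapT => H; have u0 x : u x = 0.
    by apply/eqP/negPn/negP => ux; apply: H; exists x.
  move: um; rewrite Lpnorm2_sqr integral0_eq.
    by move=> /eqP; rewrite eqe eq_sym gt_eqF.
  by move=> x _; rewrite u0 expr0n.
have K := integrable_fin_num measurableT (L2_sqr_integrable g2).
have mp : measurable_fun setT (fun t => (`|u t| `^ p)%:E).
  apply/measurable_EFinP/(measurableT_comp (measurable_powR _)).
  by apply: measurableT_comp => //; exact: L2_measurable.
have P0 : (0 <= \int[mu]_x (`|u x| `^ p)%:E)%E.
  by apply: integral_ge0 => x _; rewrite lee_fin powR_ge0.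
(* An infinite potential term makes the energy +oo; otherwise all terms are finite and the real
   inequality applies. *)
have [Poo|Pfin] := eqVneq (\int[mu]_x (`|u x| `^ p)%:E)%E +oo%E.
  rewrite Poo gt0_muley ?lte_fin ?invr_gt0; last by lra.
  rewrite addey ?addye// .
  by rewrite -(fineK K) -EFinM.
have ip : mu.-integrable setT (EFin \o (fun t => `|u t| `^ p)).
  apply/integrableP; split => //=.
  under eq_integral do rewrite ger0_norm ?powR_ge0//.
  by rewrite ltey.
have := energy_density_gt p2 p8 qE cu u2 g2 pu ip ux.
have ig2 := L2_sqr_integrable g2.
rewrite RintegralD//; [|exact: integrable_EFinZ..].
rewrite !RintegralZl// => H.
have K' := integrable_fin_num measurableT ip.
rewrite -(fineK K) -(fineK K') -!(EFinM, EFinN, EFinD) lte_fin subr_gt0.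
exact: H.
Qed.

End ground_energy.

Unset Implicit Arguments.

Theorem theorem1p7 (R : realType) (p q : R) (hp : 2 < p) (hq : q = p / 2 + 1)
    (m : R) (hm : 0 < m) :
  ~ exists2 u : R -> R, H1_mass m u & energy p q u = ground_energy p q m.
Proof.
move=> [u mu uE].
have below (e : \bar R) : (exists2 v, H1_mass m v & (energy p q v < e)%E) ->
    (energy p q u < e)%E.
  by move=> [v mv]; apply: le_lt_trans; rewrite uE; exact: ground_energy_le.
have [p8|p8] := leP p 8.
  have Epos := energy_gt0 hp p8 hq hm mu.
  have q0 : 0 < q by lra.
  (* A finite positive minimum is undercut by a competitor of energy below that very value, an
     infinite one by a competitor of energy below 1. *)
  have [e|E] : energy p q u \is a fin_num \/ energy p q u = +oo%E.
    move: Epos; case: (energy p q u) => [r||] //; first by left.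
    by right.
  - have Ef : 0 < fine (energy p q u).
      by rewrite fine_gt0// Epos /= -ge0_fin_numE// ltW.
    have := below _ (energy_arbitrarily_small hp q0 hm Ef).
    by rewrite fineK// ltxx.
  - have := below _ (energy_arbitrarily_small hp q0 hm ltr01).
    by rewrite E.
(* With [L] the point term of [u] itself, the energy of [u] is at least [- L], the other two terms
   being nonnegative. *)
have L0 : 0 <= q^-1 * `|u 0| `^ q.
  by rewrite mulr_ge0 ?powR_ge0 ?invr_ge0//; lra.
have := below _ (energy_unbounded_below p8 hq hm L0).
apply/negP; rewrite -leNgt /energy EFinN leeDr//.
by rewrite adde_ge0// mule_ge0 ?poweR_ge0 ?lee_fin ?invr_ge0//; lra.
Qed.
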